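(* Let $G$ be a nonelementary hyperbolic group, and let $\mathcal{H}=\{H_1,\ldots,H_n\}$ be an almost malnormal collection of proper, quasiconvex subgroups of $G$. Then $G$ is hyperbolic relative to $\mathcal{H}$.
   Context: A (finite) collection $\mathcal{H}=\{H_1,\ldots,H_n\}$ of subgroups of a group $G$ is almost malnormal if, whenever $g\in G$ and $i,j$ are such that $H_i\cap g^{-1}H_jg$ is infinite, one has $i=j$ and $g\in H_i$. ''Hyperbolic group'' means (Gromov) hyperbolic finitely generated group; ''nonelementary'' means not virtually cyclic (in particular infinite). A subgroup $H$ of a hyperbolic group $G$ is quasiconvex if, for some (equivalently any) Cayley graph $\Gamma$ of $G$ with respect to a finite generating set, there is $\lambda\ge 0$ such that every geodesic in $\Gamma$ with endpoints in $H$ lies in the $\lambda$-neighborhood of $H$. Quasiconvex subgroups are finitely generated. Relative hyperbolicity (standard definition via the cusped space): let $G$ be finitely generated and $\mathcal{H}=\{H_1,\ldots,H_n\}$ a finite collection of finitely generated subgroups. Choose a finite generating set $S$ of $G$ such that $S\cap H_i$ generates $H_i$ for each $i$, and let $\Gamma=\Gamma(G,S)$ be the Cayley graph. For a connected graph $Y$ the combinatorial horoball on $Y$ is the graph with vertex set $Y^{(0)}\times\{0,1,2,\ldots\}$, with an edge joining $(v,k)$ to $(w,k)$ whenever $0<d_Y(v,w)\le 2^k$, and an edge joining $(v,k)$ to $(v,k+1)$ for all $v,k$. The cusped space is obtained from $\Gamma$ by gluing, for each $i$ and each left coset $gH_i$, a combinatorial horoball on the translate by $g$ of the Cayley graph of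 $H_i$ with respect to $S\cap H_i$ along its level $k=0$. The group $G$ is hyperbolic relative to $\mathcal{H}$ (equivalently, the pair $(G,\mathcal{H})$ is relatively hyperbolic) if the cusped space is Gromov hyperbolic; this does not depend on $S$. *)

(* Defs.v *)
From HB Require Import structures.
From mathcomp Require Import all_boot all_order all_algebra.
From mathcomp Require Import mathcomp_extra boolp classical_sets cardinality.

Set Implicit Arguments.
Unset Strict Implicit.
Unset Printing Implicit Defensive.

Import Order.TTheory GRing.Theory Num.Theory.

Local Open Scope classical_set_scope.
Local Open Scope group_scope.

(* A graph on T is given by its adjacency relation e : rel T; it is regarded   *)
(* as a metric space through the path metric on its vertices (edges have       *)
(* length 1).                                                                  *)
Section Graph.
Variables (T : Type) (e : rel T).
Implicit Types x y z w : T.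

Definition walk x y (m : nat) : Prop :=
  exists p : seq T, [/\ path e x p, last x p = y & size p = m].

(* The value is 0 when x and y lie in different components.                    *)
Definition gdist x y : nat :=
  xget 0%N [set m | walk x y m /\ forall k, walk x y k -> (m <= k)%N].

(* x :: p is the sequence of vertices of a geodesic edge path.                 *)
Definition geodesic x (p : seq T) : Prop :=
  path e x p /\ size p = gdist x (last x p).

Definition gromov_product w x y : rat :=
  (((gdist x w)%:R + (gdist y w)%:R - (gdist x y)%:R) / 2)%R.

Definition gromov_hyperbolic : Prop :=
  exists2 delta : rat, (0 <= delta)%R & forall w x y z,
    (Num.min (gromov_product w x y) (gromov_product w y z) - delta
       <= gromov_product w x z)%R.

End Graph.

(* Combinatorial horoball on Y; the vertex (v, k) is at depth k.               *)
Definition horoball (V : eqType) (Y : rel V) : rel (V * nat) := fun a b =>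
  [|| (a.2 == b.2) && (0 < gdist Y a.1 b.1 <= 2 ^ a.2)%N,
      (a.1 == b.1) && (b.2 == a.2.+1)
    | (a.1 == b.1) && (a.2 == b.2.+1)].

Section Groups.
Variable G : groupType.
Implicit Types (S : seq G) (H K : groupClosed G).

Definition generates (A : {pred G}) H : Prop :=
  {subset A <= H} /\ forall K, {subset A <= K} -> {subset H <= K}.

Definition generates_group S : Prop :=
  forall K, {subset S <= K} -> forall g, g \in K.

Definition cayley (A : {pred G}) : rel G := fun x y =>
  (x != y) && ((x^-1 * y \in A) || (y^-1 * x \in A)).

Definition finite_index H : Prop :=
  exists T : seq G, forall g, exists2 t, t \in T & t^-1 * g \in H.

Definition virtually_cyclic : Prop :=
  exists K, finite_index K /\ exists c, generates (pred1 c) K.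

Definition hyperbolic_group : Prop :=
  exists2 S, generates_group S & gromov_hyperbolic (cayley (mem S)).

Definition quasiconvex H : Prop :=
  exists2 S, generates_group S &
  exists lambda : nat, forall x p, geodesic (cayley (mem S)) x p ->
    x \in H -> last x p \in H ->
    forall y, y \in x :: p ->
    exists2 h, h \in H & (gdist (cayley (mem S)) y h <= lambda)%N.

Definition almost_malnormal (n : nat) (H : 'I_n -> groupClosed G) : Prop :=
  forall g i j,
    infinite_set ([set` H i] `&` [set h ^ g | h in [set` H j]]) ->
    i = j /\ g \in H i.

(* cayley [predI S & H i], as a graph on all of G, is the disjoint union over  *)
(* the left cosets g(H i) of the g-translates of the Cayley graph of H i with  *)
(* respect to S \cap H i; since vertices in different components are at gdist  *)
(* 0, the horoball on it is the disjoint union of the horoballs on these       *)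
(* translates.                                                                 *)
Definition peripheral_graph S H : rel G := cayley [predI S & H].

(* The vertices of the cusped space are those of the Cayley graph, inl g, and  *)
(* the vertices of positive depth of the horoballs: inr (i, v, k) is the       *)
(* vertex (v, k.+1) of the horoball on the coset v(H i).  The vertices (v, 0)  *)
(* are identified with inl v; the horoball edges of depth 0 are then already   *)
(* edges of the Cayley graph.                                                  *)
Definition cusped_space (n : nat) S (H : 'I_n -> groupClosed G) :
    rel (G + 'I_n * G * nat) := fun a b =>
  match a, b with
  | inl x, inl y => cayley (mem S) x y
  | inl x, inr (i, w, l) => horoball (peripheral_graph S (H i)) (x, 0) (w, l.+1)
  | inr (i, v, k), inl y => horoball (peripheral_graph S (H i)) (v, k.+1) (y, 0)
  | inr (i, v, k), inr (j, w, l) =>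
      (i == j) && horoball (peripheral_graph S (H i)) (v, k.+1) (w, l.+1)
  end.

Definition relatively_hyperbolic (n : nat) (H : 'I_n -> groupClosed G) : Prop :=
  exists S, [/\ generates_group S,
                forall i, generates [predI S & H i] (H i)
              & gromov_hyperbolic (cusped_space S H)].

End Groups.

Arguments virtually_cyclic : clear implicits.
Arguments hyperbolic_group : clear implicits.

(* Main.v *)
From HB Require Import structures.
Require Import Defs.
From mathcomp Require Import all_boot all_order all_algebra.
From mathcomp Require Import mathcomp_extra boolp classical_sets functions cardinality.
From mathcomp Require Import zify lra.

Set Implicit Arguments.
Unset Strict Implicit.
Unset Printing Implicit Defensive.

(** Hyperbolicity of the cusped space is obtained by guessing its geodesics.
A path metric is hyperbolic as soon as one can attach to each pair of points
[x], [y] a set [L x y] such that the triangles with sides [L] are uniformly slim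
and have a uniformly coarse center, and [L x y] is bounded when [x] and [y] are
adjacent ([guessing_hyperbolic]).  As in the Morse lemma, such sets stay near all
geodesics: along a path of length [2 ^ k] slimness costs only [k] steps, and this
logarithm cannot compete with the linear growth of a detour ([stability]).  These
hypotheses on [L] survive a bilipschitz change of the metric, so hyperbolicity
and quasiconvexity pass from one finite generating set to another.

Choose the generating set so that it contains finite generating sets of the
subgroups.  Then in the word metric the cosets of the subgroups are uniformly
quasiconvex and undistorted.  Two different cosets can be close to each other
only along a bounded set ([cosets_separated]): two geodesics that fellow-travel
for a long time repeat the same short transition element, which makes
an intersection of conjugates infinite, against almost malnormality.

The guess for the cusped space is [track].  Follow a word geodesic from [x] to
[y]; whenever it travels for long along a coset, replace that stretch by the path
in the horoball which climbs above the projection of [x] to the coset, crosses at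
the height where the two projections become neighbors, and descends above the
projection of [y].  When the geodesic from [x] to [z] runs inside a coset on which
a third point [y] projects in the middle, the comparison takes place inside the
horoball, where triangles of climbing paths are slim for elementary reasons;
when it stays outside the cosets, the comparison is the four point inequality of
the group, except near the end of a coset, which then belongs to another track.
Separation of the cosets ensures that two of them never compete for the same
stretch of geodesic.  All these facts require only upper bounds on distances in
the cusped space ([cusping]), never the exact value of its metric. *)

(** * Guessing geodesics *)

Definition isometric_path T (d : T -> T -> nat) (a : nat -> T) n :=
  forall i j, i <= j <= n -> d (a i) (a j) = j - i.

(** The path metric of a connected graph, with geodesics as sequences of vertices;
that [d x y = 0] forces [x = y] follows from the last clause. *)
Record geodesic_metric T (d : T -> T -> nat) : Prop := GeodesicMetric {
  gm_refl : forall x, d x x = 0;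
  gm_sym : forall x y, d x y = d y x;
  gm_tri : forall x y z, d x z <= d x y + d y z;
  gm_geod : forall x y, exists a,
    [/\ a 0 = x, a (d x y) = y & isometric_path d a (d x y)] }.

(** Gromov's condition on products based at [w], doubled to avoid fractions. *)
Definition four_point T (d : T -> T -> nat) delta := forall w x y z,
  d x z + d w y <= d x y + d w z + delta \/
  d x z + d w y <= d y z + d w x + delta.

(** Equivalently the Gromov product of [x] and [y] at [u] is at most [C / 2]; in a
hyperbolic space this is coarsely the union of the geodesics from [x] to [y]. *)
Definition between T (d : T -> T -> nat) C x y u := d x u + d u y <= d x y + C.

(** The center clause replaces the usual requirement that each [L x y] be connected:
connectedness is only ever used to find a point near all three sides. *)
Record slim_centered T (d : T -> T -> nat) (L : T -> T -> T -> Prop) h : Prop :=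
  SlimCentered {
  sc_slim : forall x y z w, L x z w ->
    exists2 w', L x y w' \/ L y z w' & d w w' <= h;
  sc_local : forall x y w, d x y <= 1 -> L x y w -> d x w <= h;
  sc_center : forall x y z, exists u, [/\ exists2 v, L x y v & d u v <= h,
    exists2 v, L y z v & d u v <= h & exists2 v, L x z v & d u v <= h] }.

Section Guessing.
Variables (T : Type) (d : T -> T -> nat) (L : T -> T -> T -> Prop) (h : nat).
Hypotheses (dG : geodesic_metric d) (LS : slim_centered d L h).

(** Bisection: each halving of the path costs one application of slimness. *)
Lemma log_close a n k i j w : isometric_path d a n ->
  i <= j <= n -> j - i <= 2 ^ k -> L (a i) (a j) w ->
  exists2 t, i <= t <= j & d w (a t) <= h * k.+1.
Proof.
move=> aG; elim: k i j w => [|k IH] i j w ij ijk Lw.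
  exists i; first lia.
  have := sc_local LS _ Lw; rewrite aG // (gm_sym dG w) muln1; apply.
  by rewrite expn0 in ijk.
rewrite expnS in ijk.
have [m [m1 m2 m3]] : exists m, [/\ i <= m <= j, m - i <= 2 ^ k & j - m <= 2 ^ k].
  by exists (minn j (i + 2 ^ k)); split; lia.
have [w' Lw' ww'] := sc_slim LS (a m) Lw.
have [t t1 t2] : exists2 t, i <= t <= j & d w' (a t) <= h * k.+1.
  by case: Lw' => Lw'; have [||t ? ?] := IH _ _ _ _ _ Lw'; try lia; exists t => //; lia.
by exists t => //; have := gm_tri dG w w' (a t); nia.
Qed.

(** With [B = h * (k + 3)] this is the room needed in [stability]: a segment of
length [4 * B + 8 * h + 2] has at most [2 ^ k] steps. *)
Lemma log_bound (c : nat) : exists k, 4 * c * (k + 3) + 8 * c + 2 <= 2 ^ k.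
Proof.
exists (c + 9); elim: c => [//|c IH].
rewrite addSn expnS; move: IH.
suff : 16 * c + 8 * 12 + 24 <= 2 ^ (c + 9) by nia.
elim: c => [//|c IH]; rewrite addSn expnS; lia.
Qed.

(** Induction on the length of the geodesic.  Let [p] be the point nearest to [w] and
cut the geodesic at distance [K] on both sides of [p].  By slimness [w] is [2 * h]-close
to a guess for one of the three pieces.  The outer pieces are excluded since, by
induction, they would bring [w] close to a point far from [p]; on the middle piece,
whose length is controlled by [B], the logarithmic estimate is good enough. *)
Lemma stability : exists B, forall a n i j w, isometric_path d a n ->
  i <= j <= n -> L (a i) (a j) w -> exists2 t, i <= t <= j & d w (a t) <= B.
Proof.
have [k kP] := log_bound h.
pose B := h * (k + 3); exists B => a n i j w aG.
have [l] := ubnP (j - i); elim: l i j w => // l IH i j w ijl ij Lw.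
have IH' i' j' w' : i <= i' -> i' <= j' -> j' <= j -> j' - i' < j - i ->
    L (a i') (a j') w' -> exists2 t, i' <= t <= j' & d w' (a t) <= B.
  by move=> ? ? ? ? ?; apply: IH => //; lia.
have [p ijp pmin] : exists2 p, i <= p <= j &
    forall t, i <= t <= j -> d w (a p) <= d w (a t).
  have ii : exists m, [exists t : 'I_j.+1, (i <= t) && (d w (a t) == m)].
    exists (d w (a j)); apply/existsP; exists ord_max => /=; rewrite eqxx; lia.
  case: (ex_minnP ii) => m /existsP[t /andP[it /eqP tm]] mmin.
  exists t; first by have := ltn_ord t; lia.
  move=> s sij; rewrite tm; apply: mmin; apply/existsP.
  have sj : s < j.+1 by lia.
  by exists (Ordinal sj) => /=; rewrite eqxx; lia.
have [|wpB] := leqP (d w (a p)) B; first by exists p.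
pose K := 2 * B + 4 * h + 1.
have tri x y z := gm_tri dG x y z; have sym x y := gm_sym dG x y.
pose p1 := maxn i (p - K); pose p2 := minn j (p + K).
have far t : i <= t <= j -> d (a t) (a p) = (t - p) + (p - t).
  move=> tij; case: (leqP t p) => tp; first by rewrite aG; lia.
  by rewrite sym aG; lia.
have [w1 Lw1 ww1] := sc_slim LS (a p2) Lw.
(* The guesses for pieces that are a single point or at distance at least K from p. *)
have escape w' i' j' : d w w' <= 2 * h -> L (a i') (a j') w' -> i <= i' ->
    i' <= j' -> j' <= j -> (j' < j) || (i < i') ->
    (i' < j' -> (j' + K <= p) || (p + K <= i')) -> d w (a p) <= B.
  move=> ww' Lw' ? ? ? ? away.
  have [ij'|ij'] := ltnP i' j'; last first.
    have e : i' = j' by lia.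
    have := sc_local LS _ Lw'; rewrite e aG; last lia.
    have k0 : 3 * h <= B by rewrite /B; nia.
    have := tri w w' (a j'); have := pmin j'; rewrite (sym w'); lia.
  have [||||t t1 t2] := IH' i' j' w' _ _ _ _ Lw'; try lia.
  have := away ij'; have := far t; have := tri w w' (a t).
  have := tri (a t) w (a p); have := pmin t; rewrite (sym (a t) w) /K; lia.
have mid w' : d w w' <= 2 * h -> L (a p1) (a p2) w' -> d w (a p) <= B.
  move=> ww' Lw'; have [||t t1 t2] := log_close (k := k) aG _ _ Lw'; first lia.
    by move: kP; rewrite -/B; rewrite /p1 /p2 /K /B; nia.
  have := pmin t; have := tri w w' (a t); rewrite /B; lia.
suff : d w (a p) <= B by lia.
case: Lw1 => Lw1; last first.
  have [e|ne] := eqVneq p2 j; last by apply: (escape _ _ _ _ Lw1); lia.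
  have := sc_local LS _ Lw1; rewrite e aG; last lia.
  have k0 : 3 * h <= B by rewrite /B; nia.
  have := tri w w1 (a j); have := pmin j; rewrite (sym w1); lia.
have [w2 Lw2 w12] := sc_slim LS (a p1) Lw1.
have ww2 : d w w2 <= 2 * h by have := tri w w1 w2; lia.
case: Lw2 => Lw2; last exact: mid Lw2.
have [e|ne] := eqVneq p1 i; last by apply: (escape _ _ _ _ Lw2); lia.
have := sc_local LS _ Lw2; rewrite e aG; last lia.
have k0 : 3 * h <= B by rewrite /B; nia.
have := tri w w2 (a i); have := pmin i; rewrite (sym w2); lia.
Qed.

Lemma stability_between : exists B, forall x y w, L x y w -> between d B x y w.
Proof.
have [B BP] := stability; exists (2 * B) => x y w Lw.
have [a [a0 a1 aG]] := gm_geod dG x y.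
rewrite -a0 -[in L _ y]a1 in Lw.
have [|t t1 t2] := BP _ _ _ _ _ aG _ Lw; first by rewrite leqnn.
have := gm_tri dG x (a t) w; have := gm_tri dG w (a t) y.
rewrite /between -[in d x (a t)]a0 -[in d (a t) y]a1 !aG ?(gm_sym dG (a t) w); lia.
Qed.

(** The Gromov product at [w] is coarsely the distance from [w] to the guess: a center
[u] of [x], [w], [z] is near the guess for [x], [z] at distance about the Gromov product
of [x] and [z] at [w].  By slimness it is also near the guess for one of the pairs
[x], [y] and [y], [z], whose Gromov product at [w] can then hardly be larger. *)
Lemma guessing_hyperbolic : exists delta, four_point d delta.
Proof.
have [B BP] := stability_between.
have tri x y z := gm_tri dG x y z; have sym x y := gm_sym dG x y.
exists (20 * h + 10 * B) => w x y z.
have [u [[v1 /BP b1 e1] [v2 /BP b2 e2] [v3 Lv3 e3]]] := sc_center LS x w z.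
have [v4 [/BP b4|/BP b4] e4] := sc_slim LS y Lv3; move: b1 b2 b4;
  have := BP _ _ _ Lv3; rewrite /between;
  have := tri w u v1; have := tri w u v2; have := tri v3 u v4;
  have := tri w v4 y; have := tri u v3 v4; have := tri w u v4;
  have := tri x v1 u; have := tri x u v3; have := tri z v2 u; have := tri z u v3;
  have := tri z v4 w; have := tri x v4 w; have := tri x u z;
  have := tri w v1 u; have := tri w v2 u;
  rewrite ?(sym y v4) ?(sym z v2) ?(sym z w) ?(sym z v4) ?(sym z u) ?(sym z v3)
    ?(sym v1 u) ?(sym v2 u) ?(sym v3 u)
    ?(sym v1 w) ?(sym v4 w) ?(sym y w) ?(sym x w) ?(sym v2 w) ?(sym u w); lia.
Qed.

End Guessing.

(** * Intervals in hyperbolic metrics and bilipschitz changes of metric *)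

Section Hyperbolic.
Variables (T : Type) (d : T -> T -> nat) (delta : nat).
Hypotheses (dG : geodesic_metric d) (dH : four_point d delta).

Let tri := gm_tri dG.
Let sym := gm_sym dG.

Lemma betweenC C x y u : between d C x y u -> between d C y x u.
Proof. by rewrite /between (sym y x) (sym y u) (sym u x); lia. Qed.

Lemma between_slim C x y z u : between d C x z u ->
  between d (C + delta) x y u \/ between d (C + delta) y z u.
Proof.
have := dH u x y z; have := (sym u x, sym u y, sym u z); rewrite /between.
by move=> [[? ?] ?] [] ? ?; [left|right]; lia.
Qed.

(** The point at the right position on a geodesic from [x] to [y]. *)
Lemma between_snap C x y u : between d C x y u ->
  exists2 v, between d 0 x y v & d u v <= C + delta.
Proof.
have [a [a0 a1 aG]] := gm_geod dG x y.
pose t := minn (d x u) (d x y); have tD : t <= d x y by lia.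
have xt : d x (a t) = t by rewrite -{1}a0 aG; lia.
have ty : d (a t) y = d x y - t by rewrite -{1}a1 aG; lia.
move=> b; exists (a t); first by rewrite /between; lia.
have := dH u x (a t) y; have := (sym u (a t), sym u x, sym y u).
move: b xt ty; rewrite /between /t => ? ? ? [[? ?] ?].
have := tri x y u; have := tri x u y; lia.
Qed.

(** The point of a geodesic from [x] to [y] at distance half of
[d x y + d x z - d y z] from [x], as in the tripod comparison. *)
Lemma between_center x y z : exists u,
  [/\ between d (delta + 2) x y u, between d (delta + 2) y z u
    & between d (delta + 2) x z u].
Proof.
have [a [a0 a1 aG]] := gm_geod dG x y.
pose t := (d x y + d x z - d y z)./2.
have tD : t <= d x y by have := tri x y z; rewrite /t; lia.
have xt : d x (a t) = t by rewrite -{1}a0 aG; lia.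
have ty : d (a t) y = d x y - t by rewrite -{1}a1 aG; lia.
have := dH z x (a t) y.
rewrite (sym z (a t)) (sym z x) (sym z y) xt ty.
have := tri y x z; rewrite (sym y x) => t1.
exists (a t); rewrite /between xt ty (sym y (a t)) ty; split; lia.
Qed.

End Hyperbolic.

Section Bilipschitz.
Variables (T : Type) (d0 d : T -> T -> nat) (delta c : nat).
Hypotheses (d0G : geodesic_metric d0) (d0H : four_point d0 delta).
Hypotheses (dG : geodesic_metric d).
Hypotheses (dc : forall x y, d x y <= c * d0 x y).
Hypotheses (cd : forall x y, d0 x y <= c * d x y).

(** Intervals of one metric are guesses for every bilipschitz equivalent metric, as the
conditions on a guess only bound distances from above and compare points at distance
at most 1. *)
Lemma interval_slim_centered :
  exists h, slim_centered d (between d0 0) h.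
Proof.
exists (c * (2 * delta + 2 + c)); split.
- move=> x y z w /(between_slim d0G d0H y) [] /(between_snap d0G d0H) [v bv wv].
    by exists v; [left | have := dc w v; nia].
  by exists v; [right | have := dc w v; nia].
- move=> x y w; have := cd x y; have := dc x w.
  rewrite /between; nia.
- move=> x y z; have [u [b1 b2 b3]] := between_center d0G d0H x y z.
  exists u; split.
  + by have [v bv uv] := between_snap d0G d0H b1; exists v => //; have := dc u v; nia.
  + by have [v bv uv] := between_snap d0G d0H b2; exists v => //; have := dc u v; nia.
  + by have [v bv uv] := between_snap d0G d0H b3; exists v => //; have := dc u v; nia.
Qed.

Lemma bilipschitz_hyperbolic : exists delta', four_point d delta'.
Proof. by have [h hP] := interval_slim_centered; apply: guessing_hyperbolic hP. Qed.

Lemma bilipschitz_stability C : exists B, forall a n w,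
  isometric_path d a n -> between d0 C (a 0) (a n) w ->
  exists2 t, t <= n & d w (a t) <= B.
Proof.
have [h hP] := interval_slim_centered.
have [B BP] := stability dG hP.
exists (c * (C + delta) + B) => a n w aG /(between_snap d0G d0H)[v bv wv].
have [|t tn vt] := BP _ _ 0 n v aG _ bv; first lia.
exists t; first lia.
by have := dc w v; have := gm_tri dG w v (a t); nia.
Qed.

End Bilipschitz.

(** * Attaching horoballs to a separated family of quasiconvex sets *)

Definition close_to V (d : V -> V -> nat) J (Q : J -> V -> Prop) r j v :=
  exists2 q, Q j q & d v q <= r.

(** [p j x] is a nearest point projection of [x] to [Q j]. *)
Record quasiconvex_family V (d : V -> V -> nat) J (Q : J -> V -> Prop)
    (lam sep : nat -> nat) (p : J -> V -> V) : Prop := QuasiconvexFamily {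
  qf_convex : forall C j x y u, Q j x -> Q j y -> between d C x y u ->
    close_to d Q (lam C) j u;
  qf_separated : forall r j j' v w, j <> j' -> close_to d Q r j v ->
    close_to d Q r j' v ->
    close_to d Q r j w -> close_to d Q r j' w -> d v w <= sep r;
  qf_proj : forall j x, Q j (p j x);
  qf_nearest : forall j x q, Q j q -> d x (p j x) <= d x q }.

(** All that matters about the space [X] obtained from [V] by gluing a horoball to each
[Q j]: [hb j v k] is the point of depth [k] above [v] in the horoball [j], [gr] embeds
[V], and a point [x] lies above [base x], at depth [ht j x] of the horoball [j]. Distances
in [X] are only bounded from above; conversely only adjacency in [X] is inspected, and
its second case is that of an edge within a horoball. *)
Record cusping V (d : V -> V -> nat) J (Q : J -> V -> Prop)
    X (dX : X -> X -> nat) (base : X -> V) (ht : J -> X -> nat)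
    (gr : V -> X) (hb : J -> V -> nat -> X) (c : nat) : Prop := Cusping {
  cu_ground : forall j v, hb j v 0 = gr v;
  cu_mem : forall j x, 0 < ht j x -> Q j (base x);
  cu_uniq : forall j j' x, 0 < ht j x -> 0 < ht j' x -> j = j';
  cu_hb : forall j x, 0 < ht j x -> x = hb j (base x) (ht j x);
  cu_gr : forall x, (forall j, ht j x = 0) -> x = gr (base x);
  cu_gr_le : forall v w, dX (gr v) (gr w) <= d v w;
  cu_vertical : forall j v k, dX (hb j v k) (hb j v k.+1) <= 1;
  cu_horizontal : forall j v w k, Q j v -> Q j w -> d v w <= 2 ^ k ->
    dX (hb j v k) (hb j w k) <= c;
  cu_adjacent : forall x y, dX x y <= 1 ->
    (d (base x) (base y) <= 1 /\ forall j, ht j x <= 1 /\ ht j y <= 1) \/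
    exists j, [/\ 0 < ht j x, 0 < ht j y, d (base x) (base y) <= 2 ^ ht j x
                & ht j y <= (ht j x).+1] }.

Section Cusp.
Variables (V : Type) (d : V -> V -> nat) (delta : nat).
Hypotheses (dG : geodesic_metric d) (dH : four_point d delta).
Variables (J : eqType) (Q : J -> V -> Prop) (lam sep : nat -> nat) (p : J -> V -> V).
Hypothesis QF : quasiconvex_family d Q lam sep p.
Variables (X : Type) (dX : X -> X -> nat) (base : X -> V) (ht : J -> X -> nat).
Variables (gr : V -> X) (hb : J -> V -> nat -> X) (c : nat).
Hypotheses (XG : geodesic_metric dX) (CU : cusping d Q dX base ht gr hb c).

Let tri := gm_tri dG.
Let sym := gm_sym dG.
Let triX := gm_tri XG.
Let symX := gm_sym XG.

(** [proj_slack] is the error in the statement that a geodesic from [x] to a point of [Q j]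
passes through the projection of [x], and [exit_slack] the error for a geodesic from
[x] to [y] when the two projections are far apart. *)
Definition proj_slack := 3 * (delta + 2) + 2 * lam (delta + 2).
Definition exit_slack := proj_slack + delta.
(** Projections further apart than [threshold] force a geodesic to run along [Q j]; the
[sep] terms make such a stretch too long to be shared by two members of the family. *)
Definition threshold := 2 * proj_slack + delta + sep (lam exit_slack) +
  sep (lam (exit_slack + 2 * delta)).
(** Twice [margin] exceeds [threshold], so that a point of a geodesic can only be inside
[Q j] when the projections of the ends are further apart than [threshold]. *)
Definition margin := threshold + 2 * delta + 1.

Definition entry j x := p j (base x).

(** Seen from [x], the point [u] comes after the place where geodesics from [x] enter
[Q j].  For [x] in the horoball over [Q j] this is declared true of all [u], even near
[base x], since the track from [x] need not come down to the ground. *)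
Definition past r j x u :=
  (0 < ht j x) || (d (base x) (entry j x) + r <= d (base x) u).
(** On a geodesic from [x] to [y], the points that are past for both ends are those of the
stretch along [Q j] that the track replaces by a path in the horoball.  The position
along the geodesic, rather than the distance to [Q j], makes this independent of the
constants of quasiconvexity. *)
Definition inside r j x y u := past r j x u && past r j y u.
Definition crosses j x y := [|| 0 < ht j x, 0 < ht j y |
  threshold < d (entry j x) (entry j y)].
(** The depth at which the two vertical paths become neighbors. *)
Definition apex j x y :=
  maxn (maxn (ht j x) (ht j y)) (up_log 2 (d (entry j x) (entry j y))).
Definition leg j x y z :=
  exists2 m, ht j x <= m <= apex j x y & z = hb j (entry j x) m.
Definition shallow x y z := exists2 u, z = gr u &
  between d 0 (base x) (base y) u /\ forall j, ~~ inside margin j x y u.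
Definition track x y z :=
  shallow x y z \/ exists2 j, crosses j x y & leg j x y z \/ leg j y x z.

Lemma insideC r j x y u : inside r j x y u = inside r j y x u.
Proof. by rewrite /inside andbC. Qed.

Lemma crossesC j x y : crosses j x y = crosses j y x.
Proof. by rewrite /crosses orbCA sym. Qed.

Lemma apexC j x y : apex j x y = apex j y x.
Proof. by rewrite /apex sym [maxn (ht j x) _]maxnC. Qed.

Lemma trackC x y z : track x y z -> track y x z.
Proof.
case=> [[u -> [b nd]]|[j jb l]]; [left|right].
  by exists u => //; split=> [|j]; [exact: betweenC | rewrite insideC].
by exists j; [rewrite crossesC | case: l; [right|left]].
Qed.

Lemma proj_self j x : 0 < ht j x -> entry j x = base x.
Proof.
move=> /(cu_mem CU) Qx; have := qf_nearest QF (base x) Qx.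
rewrite (gm_refl dG) leqn0 => /eqP e0.
by have [a [a0 a1 _]] := gm_geod dG (base x) (entry j x); rewrite -a1 e0 a0.
Qed.

(** A center of [x], its projection and [q] is near [Q j] by quasiconvexity, hence near
the projection. *)
Lemma proj_between j x q : Q j q -> d x (p j x) + d (p j x) q <= d x q + proj_slack.
Proof.
move=> Qq; have Qp := qf_proj QF j x.
have [m [b1 b2 b3]] := between_center dG dH x (p j x) q.
have [q' Qq' mq'] := qf_convex QF Qp Qq b2.
have := qf_nearest QF x Qq'; have := tri x m q'; have := tri (p j x) m q.
move: b1 b2 b3; have := sym (p j x) m; rewrite /between /proj_slack; lia.
Qed.

Lemma threshold_between j x y : threshold < d (p j x) (p j y) ->
  between d exit_slack x y (p j x).
Proof.
move=> far; have Qx := qf_proj QF j x; have Qy := qf_proj QF j y.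
have := proj_between x Qy; have := proj_between y Qx.
have b : between d proj_slack x (p j y) (p j x) by rewrite /between;
  have := proj_between x Qy; lia.
have [//|] := between_slim dG dH y b.
move: far; rewrite /between /exit_slack /threshold (sym (p j y) (p j x)); lia.
Qed.

(** By the four point inequality [u] is near a geodesic from the entry point to [x] or to
[y], and it is too far from [x] for the former. *)
Lemma past_slim C r j x y u : between d C (base x) y u -> past r j x u ->
  C + delta < r -> between d (C + delta) (entry j x) y u.
Proof.
move=> b /orP[hx|bx] Cr; first by move: b; rewrite proj_self // /between; lia.
have [|//] := between_slim dG dH (entry j x) b.
by move: bx; rewrite /between; lia.
Qed.

Lemma inside_close C r j x y u : between d C (base x) (base y) u ->
  inside r j x y u -> C + 2 * delta < r -> close_to d Q (lam (C + 2 * delta)) j u.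
Proof.
move=> b /andP[dx dy] Cr; have Qx := qf_proj QF j (base x).
have {}b : between d (C + delta) (entry j x) (base y) u.
  by apply: past_slim b dx _; lia.
have := past_slim (betweenC dG b) dy; rewrite -addnA addnn -mul2n => b'.
by apply: (qf_convex QF _ _ (b' _)) => //; exact: qf_proj QF j _.
Qed.

Lemma inside_crosses C r j x y u : between d C (base x) (base y) u ->
  inside r j x y u -> threshold + C < 2 * r -> crosses j x y.
Proof.
move=> b /andP[/orP[hx|dx] dy] Cr; first by rewrite /crosses hx.
case/orP: dy => [hy|dy]; first by rewrite /crosses hy orbT.
have [|le] := ltnP threshold (d (entry j x) (entry j y));
  first by rewrite /crosses => ->; rewrite !orbT.
have := tri (base x) (entry j x) (base y); have := tri (entry j x) (entry j y) (base y).
move: b; have := sym (base y) u; have := sym (base y) (entry j y); rewrite /between; lia.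
Qed.

(** Used for a third point [z]: if [u] is near [Q j] but not past it, then [Q j] is entered
from [z] near [u]. *)
Lemma not_past_close C r j z u : close_to d Q C j u -> ~~ past r j z u ->
  ht j z = 0 /\ d u (entry j z) <= r + 2 * C + proj_slack.
Proof.
move=> [q Qq uq]; rewrite /past negb_or -eqn0Ngt -ltnNge => /andP[/eqP h0 uz].
split=> //; have := proj_between (base z) Qq; rewrite -/(entry j z).
have := tri (base z) u q; have := tri u q (entry j z).
have := sym q (entry j z); lia.
Qed.

Lemma ground_end j x y : crosses j x y -> ht j x = 0 -> track x y (gr (entry j x)).
Proof.
by move=> b h0; right; exists j => //; left; exists 0; rewrite ?h0 // (cu_ground CU).
Qed.

(** Move [u] to a geodesic.  If this puts it inside some [Q j], then [u] is close to the
boundary of the inside part, that is to an end of the horoball path. *)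
Lemma shallow_track C r : exists h, forall x y u,
  between d C (base x) (base y) u -> (forall j, ~~ inside r j x y u) ->
  exists2 z, track x y z & dX (gr u) z <= h.
Proof.
pose s := C + delta; pose l := s + lam (2 * delta).
exists (s + (r + 2 * l + proj_slack)) => x y u b nd.
have [v bv uv] := between_snap dG dH b.
case: (pselect (exists j, inside margin j x y v)) => [[j dv]|nv]; last first.
  exists (gr v); last by have := cu_gr_le CU u v; lia.
  by left; exists v => //; split=> // j; apply/negP => dj; apply: nv; exists j.
have jb : crosses j x y by apply: inside_crosses bv dv _; rewrite /margin; lia.
have nu : close_to d Q l j u.
  have [|q Qq vq] := inside_close bv dv; first by rewrite /margin; lia.
  by exists q => //; have := tri u v q; rewrite /l add0n in vq *; lia.
have /nandP[] := nd j => /(not_past_close nu)[h0 up].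
  by exists (gr (entry j x)); [exact: ground_end | have := cu_gr_le CU u (entry j x);
    lia].
exists (gr (entry j y)); last by have := cu_gr_le CU u (entry j y); lia.
by apply: trackC; apply: ground_end => //; rewrite crossesC.
Qed.

(** When [u] is far enough inside [Q j] and [z] does not go past it, the entry point of
[z] is near [u], hence far from the entry points of [x] and [y]. *)
Lemma branch_off C r0 : exists r s, r0 <= r /\ forall j x y z u,
  between d C (base x) (base y) u -> inside r j x y u -> ~~ past r0 j z u ->
  [/\ ht j z = 0, d u (entry j z) <= s, crosses j x z & crosses j y z].
Proof.
pose l := lam (C + 2 * delta); pose s := r0 + 2 * l + proj_slack.
pose r := C + 2 * delta + s + threshold + r0 + 1.
exists r, s; split=> [|j x y z u b dj nz]; first by rewrite /r; lia.
have nu : close_to d Q l j u by apply: (inside_close b dj); rewrite /r; lia.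
have [h0 up] := not_past_close nu nz; move/andP: dj => [dx dy].
have bigz w : past r j w u -> crosses j w z.
  case/orP=> [hw|dw]; first by rewrite /crosses hw.
  apply/or3P; apply: Or33.
  have := tri (base w) (entry j w) u; have := tri (entry j w) (entry j z) u.
  by have := sym (entry j z) u; move: dw; rewrite /r; lia.
by split=> //; apply: bigz.
Qed.

(** A point [u] of the side [x z] is near another side, say [x y].  If it is inside [Q j]
for [x y] but not for [x z], then [z] branches off from [Q j] near [u], and there the
track from [y] to [z] touches the ground. *)
Lemma shallow_slim C r0 : exists h, forall x y z u,
  between d C (base x) (base z) u -> (forall j, ~~ inside r0 j x z u) ->
  exists2 w, track x y w \/ track y z w & dX (gr u) w <= h.
Proof.
have [r [s [r0r rsP]]] := branch_off (C + delta) r0.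
have [h hP] := shallow_track (C + delta) r.
exists (s + h).
have half x y z u : (forall j, ~~ inside r0 j x z u) ->
    between d (C + delta) (base x) (base y) u ->
    exists2 w, track x y w \/ track y z w & dX (gr u) w <= s + h.
  move=> nd b; case: (pselect (exists j, inside r j x y u)) => [[j dj]|nj]; last first.
    have [|w tw uw] := hP x y u b; last by exists w; [left | lia].
    by move=> j; apply/negP => dj; apply: nj; exists j.
  have nz : ~~ past r0 j z u.
    have /nandP[|//] := nd j; move/andP: dj => [dx _].
    by move: dx; rewrite /past; lia.
  have [h0 up _ jb] := rsP _ _ _ _ _ b dj nz.
  exists (gr (entry j z)); last by have := cu_gr_le CU u (entry j z); lia.
  by right; apply: trackC; apply: ground_end => //; rewrite crossesC.
move=> x y z u b nd; have [|b'] := between_slim dG dH (base y) b; first exact: half.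
have [|w tw uw] := half z y x u _ (betweenC dG b').
  by move=> j; rewrite insideC.
by exists w => //; case: tw => /trackC; [right|left].
Qed.

Lemma hb_vertical j v k l : dX (hb j v k) (hb j v l) <= (k - l) + (l - k).
Proof.
wlog kl : k l / k <= l.
  by move=> W; case: (leqP k l) => kl; [exact: W | rewrite symX addnC; apply: W; lia].
elim: l kl => [|l IH] kl.
  by rewrite leqn0 in kl; rewrite (eqP kl) (gm_refl XG).
have [->|ne] := eqVneq k l.+1; first by rewrite (gm_refl XG).
have := triX (hb j v k) (hb j v l) (hb j v l.+1); have := cu_vertical CU j v l.
have := IH; lia.
Qed.

(** Slimness inside one horoball.  Up to the apex of [x y] the leg is shared with the
track to [y].  Above it the entry points of [x] and [y] are neighbors, and since the
apex is an ultrametric up to one level, the leg of [y] can be used instead. *)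
Lemma leg_slim j x y z w : leg j x z w ->
  exists2 w', leg j x y w' \/ leg j y z w' & dX w w' <= c + 1.
Proof.
case=> m /andP[m1 m2] ->.
have [le|gt] := leqP m (apex j x y).
  by exists (hb j (entry j x) m); [left; exists m; rewrite ?m1 | rewrite (gm_refl XG)].
have [e|ne] := eqVneq m (apex j x y).+1.
  exists (hb j (entry j x) (apex j x y));
    last by have := hb_vertical j (entry j x) m (apex j x y); lia.
  by left; exists (apex j x y) => //; rewrite leqnn /apex; lia.
have dxy : d (entry j x) (entry j y) <= 2 ^ (m - 2).
  apply: leq_trans (up_logP _ (ltnSn 1)) _; rewrite leq_exp2l //; move: gt ne;
    rewrite /apex; lia.
have m2E : 2 ^ m = 2 * 2 ^ (m - 1) /\ 2 ^ (m - 1) = 2 * 2 ^ (m - 2).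
  by rewrite -!expnS; split; congr (2 ^ _); lia.
exists (hb j (entry j y) (m - 1)); last first.
  have := hb_vertical j (entry j y) m (m - 1).
  have := triX (hb j (entry j x) m) (hb j (entry j y) m) (hb j (entry j y) (m - 1)).
  have := cu_horizontal CU (qf_proj QF j (base x)) (qf_proj QF j (base y)) (k := m).
  rewrite -!/(entry j _); lia.
right; exists (m - 1) => //; apply/andP; split; first by move: gt; rewrite /apex; lia.
have [|ltz] := leqP m (ht j z); first by rewrite /apex; lia.
have : m <= up_log 2 (d (entry j x) (entry j z)) by move: m2 gt; rewrite /apex; lia.
move=> mz; suff : m - 1 <= up_log 2 (d (entry j y) (entry j z)) by rewrite /apex; lia.
have [//|lt] := leqP (m - 1) (up_log 2 (d (entry j y) (entry j z))).
have dyz : d (entry j y) (entry j z) <= 2 ^ (m - 2).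
  by apply: leq_trans (up_logP _ (ltnSn 1)) _; rewrite leq_exp2l //; lia.
have : up_log 2 (d (entry j x) (entry j z)) <= m - 1.
  by apply: up_log_min => //; have := tri (entry j x) (entry j y) (entry j z); lia.
by move: gt; lia.
Qed.

Lemma small_leg j x y w : ~~ crosses j x y -> leg j x y w ->
  [/\ ht j x = 0, ht j y = 0, d (entry j x) (entry j y) <= threshold
    & dX w (gr (entry j x)) <= up_log 2 threshold].
Proof.
rewrite /crosses !negb_or -!eqn0Ngt -leqNgt => /and3P[/eqP hx /eqP hy le] [m m1 ->].
split=> //; rewrite -(cu_ground CU j).
have := hb_vertical j (entry j x) m 0; have := leq_up_log 2 le.
by move: m1; rewrite /apex hx hy; lia.
Qed.

(** Neither of the two short sides crosses [Q j], although [x z] does.  The entry point of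
[x] is then treated as a point on the ground: were it well inside another [Q j'] for
[x z], so would be the exit point, and the two members of the family would be close to
each other over a distance larger than [threshold], against their separation. *)
Lemma turn_slim : exists h, forall j x y z,
  crosses j x z -> ~~ crosses j x y -> ~~ crosses j y z ->
  exists2 w, track x y w \/ track y z w & dX (gr (entry j x)) w <= h.
Proof.
(* The crossing has length at most 2 * threshold, so this leaves the exit point inside. *)
pose r := 2 * threshold + exit_slack + 2 * delta + 1.
have [h hP] := shallow_slim exit_slack r; exists h => j x y z bxz nxy nyz.
move: nxy nyz; rewrite /crosses !negb_or -!eqn0Ngt -!leqNgt.
move=> /and3P[/eqP hx /eqP hy dxy] /and3P[_ /eqP hz dyz].
have dxz : threshold < d (entry j x) (entry j z) by move: bxz; rewrite /crosses hx hz.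
have le2 : d (entry j x) (entry j z) <= 2 * threshold.
  by have := tri (entry j x) (entry j y) (entry j z); lia.
apply: hP; first exact: threshold_between.
move=> j'; apply/negP => dj; have [e|ne] := eqVneq j' j.
  by move: dj => /andP[dx _]; move: dx; rewrite e /past hx; rewrite /r; lia.
have nx : close_to d Q (lam (exit_slack + 2 * delta)) j' (entry j x).
  by apply: (inside_close (threshold_between dxz) dj); rewrite /r; lia.
have nz : close_to d Q (lam (exit_slack + 2 * delta)) j' (entry j z).
  apply: (@inside_close _ (exit_slack + 2 * delta + 1) j' x z).
  + by apply: betweenC => //; apply: threshold_between; rewrite sym.
  + have cl w : past r j' w (entry j x) ->
      past (exit_slack + 2 * delta + 1) j' w (entry j z).
      case/orP=> [hw|dw]; first by rewrite /past hw.
      apply/orP; right; have := tri (base w) (entry j z) (entry j x).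
      by move: dw; rewrite /r (sym (entry j z)); lia.
    by case/andP: dj => /cl dx /cl dz; rewrite /inside dx dz.
  + by lia.
have near0 x' k : close_to d Q k j (entry j x').
  by exists (entry j x'); [exact: qf_proj QF _ _ | rewrite (gm_refl dG)].
have := qf_separated QF (elimN eqP ne) nx (near0 _ _) nz (near0 _ _).
by move: dxz; rewrite /threshold; lia.
Qed.

Lemma leg_track_slim : exists h, forall j x y z w, crosses j x z -> leg j x z w ->
  exists2 w', track x y w' \/ track y z w' & dX w w' <= h.
Proof.
have [h hP] := turn_slim; pose e := up_log 2 threshold.
exists (c + 1 + e + threshold + h) => j x y z w bxz lw.
have [w1 lw1 ww1] := leg_slim y lw.
have [bxy|nxy] := boolP (crosses j x y); have [byz|nyz] := boolP (crosses j y z).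
- exists w1; last lia.
  by case: lw1 => l1; [left|right]; right; exists j => //; left.
- case: lw1 => l1; first by exists w1; [left; right; exists j => //; left | lia].
  have [hy hz dyz wy] := small_leg nyz l1.
  exists (gr (entry j y)); last by have := triX w w1 (gr (entry j y)); lia.
  by left; apply: trackC; apply: ground_end => //; rewrite crossesC.
- case: lw1 => l1; last by exists w1; [right; right; exists j => //; left | lia].
  have [hx hy dxy wx] := small_leg nxy l1.
  exists (gr (entry j y)); first by right; apply: ground_end.
  have := triX w w1 (gr (entry j y)); have := cu_gr_le CU (entry j x) (entry j y).
  by have := triX w1 (gr (entry j x)) (gr (entry j y)); lia.
- have [w' tw' xw'] := hP j x y z bxz nxy nyz.
  exists w' => //.
  suff : dX w1 (gr (entry j x)) <= e + threshold.
    have := triX w w1 w'; have := triX w1 (gr (entry j x)) w'; lia.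
  case: lw1 => l1; first by have [_ _ _] := small_leg nxy l1; lia.
  have [_ _ _] := small_leg nyz l1.
  have := triX w1 (gr (entry j y)) (gr (entry j x));
    have := cu_gr_le CU (entry j y) (entry j x).
  move: nxy; rewrite /crosses !negb_or -!leqNgt (sym (entry j y)) /e => /and3P[_ _]; lia.
Qed.

Lemma track_slim : exists h, forall x y z w, track x z w ->
  exists2 w', track x y w' \/ track y z w' & dX w w' <= h.
Proof.
have [h1 P1] := shallow_slim 0 margin; have [h2 P2] := leg_track_slim.
exists (h1 + h2) => x y z w [[u -> [b nd]]|[j bj [l|l]]].
- by have [w' tw ww] := P1 _ y _ _ b nd; exists w' => //; lia.
- by have [w' tw ww] := P2 _ _ y _ _ bj l; exists w' => //; lia.
- have [|w' tw ww] := P2 j z y x w _ l; first by rewrite crossesC.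
  by exists w'; [case: tw => /trackC; [right|left] | lia].
Qed.

Lemma leg_level j x y k : ht j x <= k <= apex j x y -> crosses j x y ->
  track x y (hb j (entry j x) k).
Proof. by move=> kt b; right; exists j => //; left; exists k. Qed.

(** At the height of the lowest of the three apexes, the two corresponding legs have met
and both continue to at least that height in the other two sides. *)
Lemma horoball_center j x y z : crosses j x y -> crosses j y z -> crosses j x z ->
  exists u, [/\ exists2 v, track x y v & dX u v <= c,
    exists2 v, track y z v & dX u v <= c & exists2 v, track x z v & dX u v <= c].
Proof.
wlog le : x y z / apex j x y <= apex j y z /\ apex j x y <= apex j x z.
  move=> W bxy byz bxz.
  have [l1|g1] := leqP (apex j x y) (apex j y z);
    have [l2|g2] := leqP (apex j x y) (apex j x z).
  - exact: W.
  - have [||||u [u1 u2 u3]] := W x z y;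
      rewrite ?(crossesC _ z) ?(crossesC _ y x) ?(apexC _ z) //; first lia.
    exists u; split=> //; case: u2 => v tv uv; exists v => //; exact: trackC.
  - have [||||u [u1 u2 u3]] := W y z x;
      rewrite ?(crossesC _ z) ?(crossesC _ y x) ?(apexC _ z) ?(apexC _ y x) //; first lia.
    exists u; split=> //; [case: u3 => v tv uv | case: u2 => v tv uv]; exists v => //;
      exact: trackC.
  - have [l3|g3] := leqP (apex j x z) (apex j y z).
    + have [||||u [u1 u2 u3]] := W x z y;
        rewrite ?(crossesC _ z) ?(crossesC _ y x) ?(apexC _ z) //; first lia.
      exists u; split=> //; case: u2 => v tv uv; exists v => //; exact: trackC.
    + have [||||u [u1 u2 u3]] := W y z x;
        rewrite ?(crossesC _ z) ?(crossesC _ y x) ?(apexC _ z) ?(apexC _ y x) //;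
          first lia.
      exists u; split=> //; [case: u3 => v tv uv | case: u2 => v tv uv];
        exists v => //; exact: trackC.
move=> bxy byz bxz; case: le => le1 le2; pose k := apex j x y.
have hx : ht j x <= k by rewrite /k /apex; lia.
have hy : ht j y <= k by rewrite /k /apex; lia.
have dxy : d (entry j x) (entry j y) <= 2 ^ k.
  by apply: leq_trans (up_logP _ (ltnSn 1)) _; rewrite leq_exp2l // /k /apex; lia.
have refl v : dX v v <= c by rewrite (gm_refl XG).
exists (hb j (entry j x) k); split.
- by exists (hb j (entry j x) k) => //; apply: leg_level; rewrite ?hx /=.
- exists (hb j (entry j y) k); first by apply: leg_level; rewrite ?hy /=.
  by apply: (cu_horizontal CU) => //; apply: (qf_proj QF).
- by exists (hb j (entry j x) k) => //; apply: leg_level; rewrite ?hx /=.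
Qed.

(** A center of the ground points works unless it is well inside some [Q j] for one of
the sides; then all three sides cross [Q j]. *)
Lemma track_center : exists h, forall x y z, exists u,
  [/\ exists2 v, track x y v & dX u v <= h, exists2 v, track y z v & dX u v <= h
    & exists2 v, track x z v & dX u v <= h].
Proof.
pose C := delta + 2; pose r0 := threshold + C + 1.
have [r [s [r0r rsP]]] := branch_off C r0.
have [h hP] := shallow_track C r; exists (h + c) => x y z.
have Cr : threshold + C < 2 * r0 by rewrite /r0; lia.
have [u [b1 b2 b3]] := between_center dG dH (base x) (base y) (base z).
have all_big j x' y' z' : between d C (base x') (base y') u ->
    between d C (base y') (base z') u -> between d C (base x') (base z') u ->
    inside r j x' y' u -> [/\ crosses j x' y', crosses j y' z' & crosses j x' z'].
  move=> c1 c2 c3 dj.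
  have bxy : crosses j x' y' by apply: (inside_crosses c1 dj); lia.
  have weak w : past r j w u -> past r0 j w u by rewrite /past; lia.
  have [bz|nz] := boolP (past r0 j z' u); last by have [_ _] := rsP _ _ _ _ _ c1 dj nz.
  case/andP: dj => /weak dx /weak dy.
  split=> //; [apply: (inside_crosses (r := r0) c2) | apply: (inside_crosses (r :=
    r0) c3)];
    by rewrite /inside ?dx ?dy.
case: (pselect (exists j, [/\ crosses j x y, crosses j y z & crosses j x z])) =>
  [[j [jx jy jz]]|nb].
  have [v [v1 v2 v3]] := horoball_center jx jy jz; exists v.
  by split; [case: v1 | case: v2 | case: v3] => t tt vt; exists t => //; lia.
exists (gr u); have close x' y' : between d C (base x') (base y') u ->
    (forall j, ~~ inside r j x' y' u) -> exists2 v, track x' y' v & dX (gr u) v <= h + c.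
  by move=> b nd; have [v tv uv] := hP _ _ _ b nd; exists v => //; lia.
split; apply: close => // j; apply/negP => dj; apply: nb; exists j.
- exact: all_big dj.
- have [||jx jy jz] := all_big _ _ _ x b2 _ _ dj; try exact: betweenC.
  by rewrite (crossesC j x y) (crossesC j x z).
- have [|jx jy jz] := all_big _ _ _ y b3 _ b1 dj; first exact: betweenC.
  by rewrite (crossesC j y z).
Qed.

Lemma ground_close x : (forall j, ht j x <= 1) -> dX x (gr (base x)) <= 1.
Proof.
move=> hts; case: (pselect (exists j, 0 < ht j x)) => [[i hi]|nh].
  rewrite {1}(cu_hb CU hi) -(cu_ground CU i).
  by have := hb_vertical i (base x) (ht i x) 0; have := hts i; lia.
rewrite -(cu_gr CU) ?(gm_refl XG) // => i; apply/eqP.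
by rewrite eqn0Ngt; apply/negP => hi; apply: nh; exists i.
Qed.

(** For adjacent points of a horoball, another [Q j] crossed by the pair would run along
the first one for longer than separation permits. *)
Lemma leg_local : exists h, forall j x y w, dX x y <= 1 -> crosses j x y ->
  leg j x y w -> dX x w <= h.
Proof.
pose E := 2 * exit_slack + threshold + 10; exists (2 * E + 4) => j x y w xy jb [m m1 ->].
have [[bxy hts]|[i [hx hy dxy hxy]]] := cu_adjacent CU xy.
  have xgr : dX x (gr (base x)) <= 1 by apply: ground_close => i; have [] := hts i.
  have [px dp] : d (base x) (entry j x) <= E /\ d (entry j x) (entry j y) <= E.
    have [far|le] := ltnP threshold (d (entry j x) (entry j y)).
      have := threshold_between far; rewrite sym in far; have := threshold_between far.
      have := tri (entry j x) (base x) (base y);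
        have := tri (base x) (base y) (entry j y).
      have := sym (base y) (base x); have := sym (base x) (entry j x).
      have := sym (base y) (entry j y); have := tri (entry j x) (base x) (entry j y).
      rewrite /between -/(entry j x) -/(entry j y) /E; lia.
    have : crosses j x y by [].
    rewrite /crosses => /or3P[hx|hy|]; last by lia.
      by rewrite (proj_self hx) in le *; rewrite (gm_refl dG) /E; lia.
    rewrite (proj_self hy) in le *; have := tri (base x) (base y) (entry j x).
    have := sym (base y) (entry j x); rewrite /E; lia.
  have mE : m <= E + 1.
    have : up_log 2 (d (entry j x) (entry j y)) <= E.
      by apply: up_log_min => //; apply: leq_trans dp (ltnW (ltn_expl _ _)).
    have := hts j; move: m1; rewrite /apex; lia.
  have := triX x (gr (base x)) (hb j (entry j x) m).
  have := triX (gr (base x)) (gr (entry j x)) (hb j (entry j x) m).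
  have := cu_gr_le CU (base x) (entry j x).
  by have := hb_vertical j (entry j x) 0 m; rewrite (cu_ground CU); lia.
have [e|ne] := eqVneq i j.
  subst i; rewrite proj_self // in m1 *; rewrite {1}(cu_hb CU hx).
  have := hb_vertical j (base x) (ht j x) m; move: m1.
  have : up_log 2 (d (base x) (base y)) <= ht j x by apply: up_log_min.
  by rewrite /apex (proj_self hx) (proj_self hy); lia.
have far : threshold < d (entry j x) (entry j y).
  case/or3P: jb => // hj; have := cu_uniq CU hj; rewrite /= => uj.
    by rewrite (uj _ hx) eqxx in ne.
  by rewrite (uj _ hy) eqxx in ne.
have nearb v : between d exit_slack (base x) (base y) v ->
  close_to d Q (lam exit_slack) i v.
  by move=> b; apply: (qf_convex QF _ _ b); apply: (cu_mem CU).
have near0 x' k : close_to d Q k j (entry j x').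
  by exists (entry j x'); [exact: qf_proj QF _ _ | rewrite (gm_refl dG)].
have n1 := nearb _ (threshold_between far).
have far' : threshold < d (entry j y) (entry j x) by rewrite sym.
have n2 := nearb _ (betweenC dG (threshold_between far')).
have := qf_separated QF (elimN eqP ne) n1 (near0 _ _) n2 (near0 _ _).
by move: far; rewrite /threshold /entry; lia.
Qed.

Lemma track_local : exists h, forall x y w, dX x y <= 1 -> track x y w -> dX x w <= h.
Proof.
have [h hP] := leg_local; exists (h + 3) => x y w xy [[u -> [b nd]]|[j jb [l|l]]].
- have [[bxy hts]|[i [hx hy _ _]]] := cu_adjacent CU xy; last first.
    by have := nd i; rewrite /inside /past hx hy.
  have xgr : dX x (gr (base x)) <= 1 by apply: ground_close => i; have [] := hts i.
  have := triX x (gr (base x)) (gr u); have := cu_gr_le CU (base x) u.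
  by move: b; rewrite /between; lia.
- by have := hP _ _ _ _ xy jb l; lia.
- have yx : dX y x <= 1 by rewrite symX.
  rewrite crossesC in jb; have := hP _ _ _ _ yx jb l.
  by have := triX x y w; lia.
Qed.

Lemma cusping_hyperbolic : exists delta', four_point dX delta'.
Proof.
have [h1 P1] := track_slim; have [h2 P2] := track_center; have [h3 P3] := track_local.
apply: (@guessing_hyperbolic _ dX track (h1 + h2 + h3)) => //; split.
- by move=> x y z w /(P1 x y z)[w' tw ww]; exists w' => //; lia.
- by move=> x y w xy /(P3 _ _ _ xy); lia.
- move=> x y z; have [u [v1 v2 v3]] := P2 x y z; exists u.
  by split; [case: v1 | case: v2 | case: v3] => t tt vt; exists t => //; lia.
Qed.

End Cusp.

(** * Graphs as geodesic metrics *)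

Section GraphMetric.
Import Order.TTheory GRing.Theory Num.Theory.
Variables (T : Type) (e : rel T).

Lemma walk_gdist x y m : walk e x y m -> walk e x y (gdist e x y) /\ gdist e x y <= m.
Proof.
move=> wm; rewrite /gdist; case: xgetP => [n _ [wn nmin]|none].
  by split=> //; apply: nmin.
exfalso; have ex : exists m, `[< walk e x y m >] by exists m; apply/asboolP.
case: (ex_minnP ex) => n /asboolP wn nmin; apply: (none n); split=> // k wk.
by apply: nmin; apply/asboolP.
Qed.

Lemma walk_refl x : walk e x x 0. Proof. by exists [::]. Qed.

Lemma gdist_refl x : gdist e x x = 0.
Proof. by have [_] := walk_gdist (walk_refl x); lia. Qed.

Lemma walk_cat x y z m n : walk e x y m -> walk e y z n -> walk e x z (m + n).
Proof.
move=> [p [pp pl <-]] [q [qp ql <-]]; exists (p ++ q).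
by rewrite cat_path last_cat pl pp qp size_cat.
Qed.

Lemma walk1 x y : e x y -> walk e x y 1.
Proof. by move=> exy; exists [:: y]; rewrite /= exy. Qed.

Lemma walk0_eq x y : walk e x y 0 -> x = y.
Proof. by case=> p [_ pl /size0nil p0]; rewrite -pl p0. Qed.

Lemma walk1_edge x y : walk e x y 1 -> e x y.
Proof. by case=> [[|z [|? ?]]] [] //= /andP[exz _] <-. Qed.

Lemma walk_split x y m i : walk e x y m -> i <= m ->
  exists2 z, walk e x z i & walk e z y (m - i).
Proof.
move=> [p [pp pl pm]] im; exists (last x (take i p)).
  by exists (take i p); move: pp; rewrite -{1}(cat_take_drop i p) cat_path => /andP[];
    rewrite size_takel ?pm.
exists (drop i p); move: pp pl;
  rewrite -{1 2}(cat_take_drop i p) cat_path last_cat => /andP[_ ?] ?.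
by rewrite size_drop pm.
Qed.

Lemma path_walk x p i k : path e x p -> i + k <= size p ->
  walk e (nth x (x :: p) i) (nth x (x :: p) (i + k)) k.
Proof.
move/(pathP x) => pp; elim: k => [|k IH] ik; first by rewrite addn0; exact: walk_refl.
rewrite addnS -[k.+1]addn1; apply: (@walk_cat _ (nth x (x :: p) (i + k))).
  by apply: IH; lia.
by apply: walk1; apply: pp; lia.
Qed.

Lemma gdist_edge x y : 0 < gdist e x y <= 1 -> e x y.
Proof.
move=> d1; case: (pselect (exists m, walk e x y m)) => [[m wm]|nw].
  have [w _] := walk_gdist wm; apply: walk1_edge.
  by have <- : gdist e x y = 1 by lia.
move: d1; rewrite /gdist; case: xgetP => [n _ [wn _]|_]; last by [].
by case: nw; exists n.
Qed.

Hypothesis e_sym : symmetric e.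

Lemma walk_sym x y m : walk e x y m -> walk e y x m.
Proof.
move=> [p [pp pl pm]]; exists (rev (belast x p)).
rewrite -pl rev_path size_rev size_belast pm; split=> //.
  by under eq_path do rewrite /= e_sym.
by case: (p) => //= a q; rewrite rev_cons last_rcons.
Qed.

Lemma gdist_sym x y : gdist e x y = gdist e y x.
Proof.
case: (pselect (exists m, walk e x y m)) => [[m wm]|nw].
  have [w1 _] := walk_gdist wm; have [w2 _] := walk_gdist (walk_sym wm).
  have [_ le1] := walk_gdist (walk_sym w1); have [_ le2] := walk_gdist (walk_sym w2).
  by apply/eqP; rewrite eqn_leq le1 le2.
have none z t : (forall m, ~ walk e z t m) -> gdist e z t = 0.
  by move=> nzt; rewrite /gdist; case: xgetP => // n _ [/nzt].
rewrite !none // => m wm; apply: nw; exists m => //; exact: walk_sym.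
Qed.

Hypothesis e_conn : forall x y, exists m, walk e x y m.

Lemma gdist_walk x y : walk e x y (gdist e x y).
Proof. by have [m /walk_gdist[]] := e_conn x y. Qed.

Lemma gdist_tri x y z : gdist e x z <= gdist e x y + gdist e y z.
Proof. by have [] := walk_gdist (walk_cat (gdist_walk x y) (gdist_walk y z)). Qed.

Lemma gdist_le1 x y : gdist e x y <= 1 -> x = y \/ e x y.
Proof.
move=> d1; have [d0|d0] := posnP (gdist e x y); last by right; apply: gdist_edge;
  rewrite d0.
by left; apply: walk0_eq; rewrite -[0]d0; exact: gdist_walk.
Qed.

Lemma gdist_edge_le x y : e x y -> gdist e x y <= 1.
Proof. by move/walk1/walk_gdist => []. Qed.

Lemma geodesic_isometric x p : geodesic e x p ->
  isometric_path (gdist e) (nth x (x :: p)) (size p).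
Proof.
move=> [pp ps] i j /andP[ij jn].
have sub k l : k <= l <= size p -> gdist e (nth x (x :: p) k) (nth x (x :: p) l) <= l - k.
  move=> kl; have := @path_walk x p k (l - k) pp; rewrite subnKC; last lia.
  by move=> W; have [|_] := walk_gdist (W _); lia.
have := gdist_tri x (nth x (x :: p) i) (last x p).
have := gdist_tri (nth x (x :: p) i) (nth x (x :: p) j) (last x p).
have := sub 0 i; have := sub i j; have := sub j (size p).
by rewrite /= -(last_nth x x) -ps; lia.
Qed.

Lemma geodesic_exists x y : exists2 p, geodesic e x p & last x p = y.
Proof.
have [p [pp pl ps]] := gdist_walk x y; exists p => //; split=> //.
by rewrite pl.
Qed.

Lemma gdist_geodesic_metric : geodesic_metric (gdist e).
Proof.
split; [exact: gdist_refl | exact: gdist_sym | exact: gdist_tri | move=> x y].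
have [p gp pl] := geodesic_exists x y; exists (nth x (x :: p)).
have ps : size p = gdist e x y by rewrite -pl; have [] := gp.
by split=> //; rewrite -ps; [rewrite -(last_nth x x) pl | exact: geodesic_isometric].
Qed.

Lemma gromov_four_point : gromov_hyperbolic e -> exists delta, four_point (gdist e) delta.
Proof.
move=> [dl dl0 H]; exists (2 * Num.bound dl) => w x y z.
have /ltW := archi_boundP dl0.
have := H w x y z; rewrite /gromov_product (gdist_sym w y) (gdist_sym w z) (gdist_sym w x).
rewrite -2!(ler_nat rat) !natrD natrM.
set N := ((Num.bound dl)%:R)%R; rewrite minEle; case: ifP => _ h1 h2;
  [left|right]; lra.
Qed.

Lemma four_point_gromov delta : four_point (gdist e) delta -> gromov_hyperbolic e.
Proof.
move=> H; exists (delta%:R)%R => [|w x y z]; first exact: ler0n.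
have := H w x y z; rewrite /gromov_product (gdist_sym w y) (gdist_sym w z) (gdist_sym w x).
rewrite -2!(ler_nat rat) !natrD minEle => H'.
have d0 := ler0n rat delta.
case: ifP => [le1|/negbT]; rewrite -?ltNge => *; case: H' => *; lra.
Qed.

End GraphMetric.

(** * Word metrics *)

Local Open Scope group_scope.

Lemma walk_lipschitz T (e : rel T) (d : T -> T -> nat) c :
  (forall x, d x x = 0%N) -> (forall x y z, d x z <= d x y + d y z)%N ->
  (forall x y, e x y -> d x y <= c)%N -> forall x y m, walk e x y m -> (d x y <= c * m)%N.
Proof.
move=> d0 tri dc x y m [p [pp <- <-]] {m y}.
elim: p x pp => [|z p IH] x /=; first by rewrite d0.
move=> /andP[/dc xz /IH zp]; have := tri x z (last z p); nia.
Qed.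

Section Cayley.
Variable G : groupType.
Implicit Types (A : {pred G}) (S : seq G) (H K : groupClosed G).

Lemma cayley_sym A : symmetric (cayley A).
Proof. by move=> x y; rewrite /cayley eq_sym orbC. Qed.

Lemma cayley_translate A g x y : cayley A (g * x) (g * y) = cayley A x y.
Proof. by rewrite /cayley (can_eq (mulKg g)) !invgM -!mulgA !mulKg. Qed.

Lemma walk_translate A g x y m : walk (cayley A) x y m ->
  walk (cayley A) (g * x) (g * y) m.
Proof.
move=> [p [pp <- <-]]; exists (map ( *%g g) p); rewrite last_map size_map; split=> //.
by elim: p x pp => //= z p IH x /andP[xz /IH ->]; rewrite cayley_translate xz.
Qed.

Lemma walk_mono A B x y m : {subset A <= B} ->
  walk (cayley A) x y m -> walk (cayley B) x y m.
Proof.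
move=> AB [p [pp pl ps]]; exists p; split=> //; apply: sub_path pp => u v.
by rewrite /cayley => /andP[-> /orP[/AB ->|/AB ->]]; rewrite ?orbT.
Qed.

Lemma cayley_mem A x g : g \in A -> exists2 m, (m <= 1)%N & walk (cayley A) x (x * g) m.
Proof.
move=> gA; have [e|ne] := eqVneq x (x * g).
  by exists 0%N => //; rewrite -e; exact: walk_refl.
by exists 1%N => //; apply: walk1; rewrite /cayley ne mulKg gA.
Qed.

Lemma walk_group A K x y m : {subset A <= K} -> walk (cayley A) x y m -> x^-1 * y \in K.
Proof.
move=> AK [p [pp <- _]]; elim: p x pp => [|z p IH] x /=; first by rewrite mulVg gpred1.
move=> /andP[xz /IH zp]; rewrite -[last z p](mulVKg z) mulgA gpredM //.
by case/andP: xz => _ /orP[/AK//|/AK]; rewrite -gpredV invgM invgK.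
Qed.

(** As a closed predicate this is the subgroup generated by [A]. *)
Definition reachable A : {pred G} := fun g => `[< exists m, walk (cayley A) 1 g m >].

Lemma reachableM A : mulg_closed (reachable A).
Proof.
move=> g h /asboolP[m wg] /asboolP[k wh]; apply/asboolP; exists (m + k)%N.
by apply: walk_cat wg _; rewrite -{1}[g]mulg1; exact: walk_translate.
Qed.

Lemma reachable1 A : 1 \in reachable A.
Proof. by apply/asboolP; exists 0%N; exact: walk_refl. Qed.

Lemma reachableV A : invg_closed (reachable A).
Proof.
move=> g /asboolP[m wg]; apply/asboolP; exists m.
by apply/(walk_sym (@cayley_sym A)); have := walk_translate g^-1 wg; rewrite mulVg mulg1.
Qed.

HB.instance Definition _ A := isMulClosed.Build G (reachable A) (@reachableM A).
HB.instance Definition _ A := isMul1Closed.Build G (reachable A) (@reachable1 A).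
HB.instance Definition _ A := isInvClosed.Build G (reachable A) (@reachableV A).

Lemma reachable_mem A g : g \in A -> g \in reachable A.
Proof.
by move=> /(cayley_mem 1)[m _]; rewrite mul1g => w; apply/asboolP; exists m.
Qed.

Lemma walk_reachable A x y : x^-1 * y \in reachable A -> exists m, walk (cayley A) x y m.
Proof.
by move=> /asboolP[m w]; exists m; have := walk_translate x w; rewrite mulg1 mulVKg.
Qed.

Lemma generates_connected S : generates_group S ->
  forall x y, exists m, walk (cayley (mem S)) x y m.
Proof. by move=> gS x y; apply: walk_reachable; apply: gS => s; exact: reachable_mem. Qed.

Lemma cayley_metric S : generates_group S -> geodesic_metric (gdist (cayley (mem S))).
Proof.
move=> gS; apply: gdist_geodesic_metric; first exact: cayley_sym.
exact: generates_connected.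
Qed.

Lemma gdist_translate S g x y : generates_group S ->
  gdist (cayley (mem S)) (g * x) (g * y) = gdist (cayley (mem S)) x y.
Proof.
move=> gS; have w a b := gdist_walk (generates_connected gS) a b.
apply/eqP; rewrite eqn_leq; apply/andP; split.
  by have [] := walk_gdist (walk_translate g (w x y)).
by have [] := walk_gdist (walk_translate g^-1 (w (g * x) (g * y))); rewrite !mulKg.
Qed.

Lemma gdist_lipschitz S S' : generates_group S -> generates_group S' ->
  exists c, forall x y, (gdist (cayley (mem S')) x y <= c * gdist (cayley (mem S)) x y)%N.
Proof.
move=> gS gS'; have dG := cayley_metric gS'; pose d := gdist (cayley (mem S')).
exists (\max_(s <- S) d 1%g s) => x y.
apply: (walk_lipschitz (gm_refl dG) (gm_tri dG));
  last exact: gdist_walk (generates_connected gS) _ _.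
have le u v : u^-1 * v \in S -> (gdist (cayley (mem S')) u v <= \max_(s <- S) d 1%g s)%N.
  move=> uv; rewrite -(gdist_translate u^-1 _ _ gS') mulVg.
  exact: (@leq_bigmax_seq G S xpredT (d 1) (u^-1 * v) uv isT).
by move=> u v /andP[_ /orP[/le //|/le]]; rewrite (gm_sym dG).
Qed.

Fixpoint ball S n : seq G :=
  if n is n'.+1 then
    ball S n' ++ [seq x * s | x <- ball S n', s <- S ++ [seq s^-1 | s <- S]]
  else [:: 1].

Lemma ball_mono S m n : (m <= n)%N -> {subset ball S m <= ball S n}.
Proof.
move=> /subnK <-; elim: (n - m)%N => [//|k IH] x xm.
by rewrite addSn /= mem_cat IH.
Qed.

Lemma walk_ball S g m : walk (cayley (mem S)) 1 g m -> g \in ball S m.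
Proof.
elim: m g => [|m IH] g w; first by rewrite -(walk0_eq w) mem_head.
have [z w1 w2] := walk_split w (leqnSn m); rewrite subSnn in w2.
have /andP[_ zg] := walk1_edge w2.
rewrite /= mem_cat; apply/orP; right; rewrite -[g](mulVKg z).
apply: allpairs_f; first exact: IH.
rewrite mem_cat; case/orP: zg => [-> //|gz]; apply/orP; right.
by apply/mapP; exists (g^-1 * z); rewrite // invgM invgK.
Qed.

Lemma gdist_ball S n x y : generates_group S ->
  (gdist (cayley (mem S)) x y <= n)%N -> x^-1 * y \in ball S n.
Proof.
move=> gS xyn; apply: (ball_mono xyn); apply: walk_ball.
have := gdist_walk (generates_connected gS) x y.
by move=> /(walk_translate x^-1); rewrite mulVg.
Qed.

End Cayley.

(** * Quasiconvex subgroups *)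

Section Quasiconvex.
Variable G : groupType.
Implicit Types (S : seq G) (H K : groupClosed G).

Lemma gpredVl H x y z : x^-1 * y \in H -> x^-1 * z \in H -> y^-1 * z \in H.
Proof.
move=> xy xz; have -> : y^-1 * z = (x^-1 * y)^-1 * (x^-1 * z).
  by rewrite invgM invgK -mulgA mulVKg.
by apply: gpredM => //; rewrite gpredV.
Qed.

Lemma gpredVr H x y z : x^-1 * y \in H -> y^-1 * z \in H -> x^-1 * z \in H.
Proof. by move=> xy yz; rewrite -[z](mulVKg y) mulgA gpredM. Qed.

Lemma gpredVC H x y : x^-1 * y \in H -> y^-1 * x \in H.
Proof. by move=> xy; rewrite -gpredV invgM invgK. Qed.

(** Subdivide a geodesic between two elements of [H] and replace its vertices by elements of
[H] at bounded distance: consecutive ones differ by an element of a fixed ball.  The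
generating set in the definition of quasiconvexity may differ from [S]. *)
Lemma quasiconvex_undistorted S H : generates_group S -> quasiconvex H ->
  exists (T : seq G) c, {subset T <= H} /\ forall x y, x^-1 * y \in H ->
    exists2 m, (m <= c * gdist (cayley (mem S)) x y)%N & walk (cayley (mem T)) x y m.
Proof.
move=> gS [S' gS' [lam qc]]; set e := cayley (mem S') in qc.
have [c cP] := gdist_lipschitz gS gS'; have dG := cayley_metric gS'.
pose T := [seq x <- ball S' (2 * lam + 1) | x \in H].
have TH : {subset T <= H} by move=> x; rewrite mem_filter => /andP[].
have edge x y : x^-1 * y \in H -> (gdist e x y <= 2 * lam + 1)%N ->
    exists2 m, (m <= 1)%N & walk (cayley (mem T)) x y m.
  move=> xyH xy; rewrite -[y](mulVKg x); apply: cayley_mem.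
  by rewrite mem_filter xyH; exact: gdist_ball.
exists T, (2 * c)%N; split=> // x y xyH.
suff [m mle w] : exists2 m, (m <= 2 * gdist e x y)%N & walk (cayley (mem T)) x y m.
  by exists m => //; have := cP x y; rewrite -/e; lia.
pose h := x^-1 * y; have xyh : gdist e x y = gdist e 1%g h.
  by rewrite -(gdist_translate x^-1 _ _ gS') mulVg.
suff [m mle /(walk_translate x) w] :
    exists2 m, (m <= 2 * gdist e 1%g h)%N & walk (cayley (mem T)) 1 h m.
  by exists m; [rewrite xyh | rewrite mulg1 mulVKg in w].
have [e1|ne1] := eqVneq 1 h; first by exists 0%N => //; rewrite -e1; exact: walk_refl.
have [p gp pl] := geodesic_exists (generates_connected gS') 1 h.
have aG := geodesic_isometric (generates_connected gS') gp.
have ps : size p = gdist e 1%g h by rewrite -pl; case: gp.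
set a := nth 1 (1 :: p) in aG.
have an : a (size p) = h by rewrite /a -(last_nth 1 1).
have near_a i : (i <= size p)%N -> exists2 k, k \in H & (gdist e (a i) k <= lam)%N.
  move=> ip; apply: qc gp _ _ _ _; rewrite ?gpred1 ?pl //.
  by apply: mem_nth; rewrite /= ltnS.
have [k [kH ak [m mle w]]] : exists k, [/\ k \in H, (gdist e (a (size p)) k <= lam)%N
    & exists2 m, (m <= size p)%N & walk (cayley (mem T)) 1 k m].
  elim: {-2}(size p) (leqnn (size p)) => [|i IH] ip.
    exists 1; split; [exact: gpred1 | by rewrite /a /= (gm_refl dG) |].
    by exists 0%N => //; exact: walk_refl.
  have [k [kH ak [m mle w]]] := IH (ltnW ip).
  have [k' k'H ak'] := near_a _ ip; exists k'; split=> //.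
  have [||l l1 wl] := edge k k'; first by rewrite gpredM ?gpredV.
    have := gm_tri dG k (a i) k'; have := gm_tri dG (a i) (a i.+1) k'.
    have := gm_sym dG k (a i); have := aG i i.+1; rewrite -/e; lia.
  by exists (m + l)%N; [lia | exact: walk_cat w wl].
have [||l l1 wl] := edge k h; first by rewrite gpredM ?gpredV.
  by have := ak; rewrite an (gm_sym dG) -/e; lia.
exists (m + l)%N; last exact: walk_cat w wl.
have : (0 < gdist e 1%g h)%N.
  rewrite lt0n; apply/eqP => d0; case/eqP: ne1.
  by apply: (@walk0_eq _ e); rewrite -[0%N]d0; apply: gdist_walk;
    exact: generates_connected.
by rewrite -ps; lia.
Qed.

(** Stability of intervals moves [u] near a geodesic for the generating set for which
[H] is known to be quasiconvex. *)
Lemma quasiconvex_between S H delta : generates_group S ->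
  four_point (gdist (cayley (mem S))) delta -> quasiconvex H ->
  forall C, exists l, forall x y u, x^-1 * y \in H ->
    between (gdist (cayley (mem S))) C x y u ->
    exists2 q, x^-1 * q \in H & (gdist (cayley (mem S)) u q <= l)%N.
Proof.
move=> gS dH [S' gS' [lam qc]] C; set d := gdist (cayley (mem S)) in dH *.
have dG := cayley_metric gS; have dG' := cayley_metric gS'.
have [c cP] := gdist_lipschitz gS gS'; have [c' cP'] := gdist_lipschitz gS' gS.
have le1 x y : (gdist (cayley (mem S')) x y <= (c + c') * d x y)%N.
  by have := cP x y; rewrite /d; nia.
have le2 x y : (d x y <= (c + c') * gdist (cayley (mem S')) x y)%N.
  by have := cP' x y; rewrite /d; nia.
have [B BP] := bilipschitz_stability dG dH dG' le1 le2 C.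
exists ((c + c') * (B + lam))%N => x y u xyH b.
have [p gp pl] := geodesic_exists (generates_connected gS') 1 (x^-1 * y).
have aG := geodesic_isometric (generates_connected gS') gp.
have b1 : between d C 1 (x^-1 * y) (x^-1 * u).
  have tr v w : d (x^-1 * v) (x^-1 * w) = d v w by exact: gdist_translate.
  by rewrite /between -(mulVg x) !tr.
have [|t tn ut] := BP _ _ (x^-1 * u) aG; first by rewrite -(last_nth 1 1) pl.
have [|||h hH ah] := qc _ _ gp _ _ (nth 1 (1 :: p) t); rewrite ?gpred1 ?pl //.
  by apply: mem_nth; rewrite /= ltnS.
exists (x * h); first by rewrite mulKg.
apply: leq_trans (le2 _ _) _; rewrite leq_mul2l -(gdist_translate x^-1 _ _ gS') mulKg.
by apply/orP; right; apply: leq_trans (gm_tri dG' _ _ _) (leq_add ut ah).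
Qed.

End Quasiconvex.

(** * Separation of the cosets of an almost malnormal family *)

Local Open Scope classical_set_scope.

Section Separation.
Variables (G : groupType) (n : nat) (H : 'I_n -> groupClosed G) (S : seq G).
Hypotheses (gS : generates_group S) (mal : almost_malnormal H).
Let d := gdist (cayley (mem S)).
Variable lam : nat -> nat.
Hypothesis lamP : forall C i x y u, x^-1 * y \in H i -> between d C x y u ->
  exists2 q, x^-1 * q \in H i & (d u q <= lam C)%N.

Let dG : geodesic_metric d := cayley_metric gS.
Let tri := gm_tri dG.
Let sym := gm_sym dG.

(** The intersection of the first subgroup with the conjugate of the second by [t.2]. *)
Definition common (t : 'I_n * 'I_n * G) : set G :=
  [set` H t.1.1] `&` [set h ^ t.2^-1 | h in [set` H t.1.2]].

Lemma common_bounded (B : seq G) : exists M, forall i j c, c \in B ->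
  finite_set (common (i, j, c)) -> forall g, common (i, j, c) g -> (d 1%g g <= M)%N.
Proof.
have /choice[f fP] (t : 'I_n * 'I_n * G) :
    exists M, finite_set (common t) -> forall g, common t g -> (d 1%g g <= M)%N.
  case: (pselect (finite_set (common t))) => [fin|inf]; last by exists 0%N.
  have /finite_seqP[s sP] := fin; exists (\max_(g <- s) d 1%g g) => _ g.
  by rewrite sP /= => gs; exact: (@leq_bigmax_seq G s xpredT (d 1) g gs isT).
exists (\max_i \max_j \max_(c <- B) f (i, j, c)) => i j c cB fin g cg.
apply: leq_trans (fP _ fin _ cg) _.
apply: leq_trans (leq_bigmax i); apply: leq_trans (leq_bigmax j).
exact: (@leq_bigmax_seq G B xpredT (fun c => f (i, j, c)) c cB isT).
Qed.

(** Points [u (k * N)] of a geodesic from [v] to [w] are close to some [a k] in the first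
coset and [b k] in the second.  The elements [(a k)^-1 * b k] lie in a ball, so two of
them coincide, and [(a k1)^-1 * a k2] is then a long element of an intersection of
conjugates.  That intersection is finite, since otherwise almost malnormality makes
the two cosets equal; the lengths of its elements are bounded. *)
Lemma cosets_separated r : exists D, forall i j g g' v w,
  ~ (i = j /\ g^-1 * g' \in H i) ->
  (exists2 q, g^-1 * q \in H i & (d v q <= r)%N) ->
  (exists2 q, g'^-1 * q \in H j & (d v q <= r)%N) ->
  (exists2 q, g^-1 * q \in H i & (d w q <= r)%N) ->
  (exists2 q, g'^-1 * q \in H j & (d w q <= r)%N) -> (d v w <= D)%N.
Proof.
(* Replacing each end of a geodesic by a point at distance r costs at most 4 * r. *)
pose l := lam (4 * r); pose B := ball S (2 * l).
(* Beyond the distance N, equal transition elements at two points give an element of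
length more than M. *)
have [M MP] := common_bounded B; pose N := (M + 2 * l + 1)%N.
exists (size B * N)%N => i j g g' v w neq [a0 a0H va0] [b0 b0H vb0] [a1 a1H wa1] [b1 b1H wb1].
rewrite leqNgt; apply/negP => far.
have [u [u0 u1 uG]] := gm_geod dG v w.
have fellow h x q0 q1 t : (t <= d v w)%N -> x^-1 * q0 \in H h -> x^-1 * q1 \in H h ->
    (d v q0 <= r)%N -> (d w q1 <= r)%N ->
      exists q, x^-1 * q \in H h /\ (d (u t) q <= l)%N.
  move=> tle q0H q1H vq0 wq1; have [||q qH uq] := @lamP (4 * r) h q0 q1 (u t).
  - exact: gpredVl q0H q1H.
  - have : (d v (u t) = t)%N by rewrite -u0 uG; lia.
    have : (d (u t) w = d v w - t)%N by rewrite -{1}u1 uG; lia.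
    have := tri q0 v (u t); have := tri (u t) w q1; have := tri v q0 w.
    have := tri q0 q1 w; have := sym q0 v; have := sym q1 w; rewrite /between; lia.
  - by exists q; split=> //; apply: gpredVr q0H qH.
have /choice[a aP] (k : 'I_(size B).+1) :
    exists q, g^-1 * q \in H i /\ (d (u (k * N)%N) q <= l)%N.
  by apply: fellow a0H a1H va0 wa1; have := ltn_ord k; nia.
have /choice[b bP] (k : 'I_(size B).+1) :
    exists q, g'^-1 * q \in H j /\ (d (u (k * N)%N) q <= l)%N.
  by apply: fellow b0H b1H vb0 wb1; have := ltn_ord k; nia.
pose c k := (a k)^-1 * b k.
have cB k : c k \in B.
  apply: gdist_ball => //; rewrite -/d; have [_ ua] := aP k; have [_ ub] := bP k.
  by have := tri (a k) (u (k * N)%N) (b k); have := sym (a k) (u (k * N)%N); lia.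
have cfin k : finite_set (common (i, j, c k)).
  apply: contrapT => inf; have [/= ij cH] := mal inf; apply: neq; split=> //.
  rewrite gpredV in cH; have [aH _] := aP k; have [bH _] := bP k.
  by apply: gpredVr (gpredVr aH cH) (gpredVC _); rewrite ij.
pose s := [seq c k | k <- enum 'I_(size B).+1].
have : ~~ uniq s.
  apply/negP => us; have : (size s <= size B)%N.
    by apply: uniq_leq_size us _ => _ /mapP[k _ ->]; exact: cB.
  by rewrite size_map size_enum_ord ltnn.
rewrite map_inj_in_uniq ?enum_uniq // => k1 k2 _ _ ce; apply/eqP/negPn/negP => k12.
wlog lt : k1 k2 ce k12 / (k1 < k2)%N.
  move=> W; case: (ltngtP k1 k2) => k12'; [exact: W k12' | | ].
    by apply: W k12' => //; rewrite eq_sym.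
  by case/eqP: k12; exact: val_inj.
have [aH1 ua1] := aP k1; have [aH2 ua2] := aP k2.
have [bH1 ub1] := bP k1; have [bH2 ub2] := bP k2.
have Pg : common (i, j, c k1) ((a k1)^-1 * a k2).
  split; first exact: gpredVl aH1 aH2.
  exists ((b k1)^-1 * b k2); first exact: gpredVl bH1 bH2.
  rewrite /conjg /= invgK {2}ce /c !invgM !invgK -!mulgA.
  by rewrite !mulVKg.
have := MP _ _ _ (cB k1) (cfin k1) _ Pg.
have -> : d 1%g ((a k1)^-1 * a k2) = d (a k1) (a k2).
  by rewrite -(mulVg (a k1)); exact: gdist_translate.
have : d (u (k1 * N)%N) (u (k2 * N)%N) = (k2 * N - k1 * N)%N.
  by apply: uG; have := ltn_ord k2; nia.
have := tri (u (k1 * N)%N) (a k1) (u (k2 * N)%N).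
have := tri (a k1) (a k2) (u (k2 * N)%N); have := sym (a k2) (u (k2 * N)%N).
have : (N <= k2 * N - k1 * N)%N by nia.
by have : N = (M + 2 * l + 1)%N by []; lia.
Qed.

End Separation.

(** * The cusped space as an attachment of horoballs *)

Section CuspedSpace.
Variables (G : groupType) (n : nat) (H : 'I_n -> groupClosed G) (S : seq G).
Hypothesis gS : generates_group S.
Let d := gdist (cayley (mem S)).
Variable b : nat.
Hypothesis bP : forall i x y, x^-1 * y \in H i ->
  exists2 m, (m <= b * d x y)%N & walk (peripheral_graph S (H i)) x y m.

Let dG : geodesic_metric d := cayley_metric gS.
Let X := (G + 'I_n * G * nat)%type.
Let eX : rel X := cusped_space S H.
Let dX := gdist eX.

(** A representative that depends only on the coset, so that cosets can be indexed by a
type with decidable equality. *)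
Definition coset_rep i v : G := xget v [set c | v^-1 * c \in H i].

Lemma coset_rep_in i v : v^-1 * coset_rep i v \in H i.
Proof.
apply: (@xgetPex _ v [set c | v^-1 * c \in H i]).
by exists v; rewrite /= mulVg gpred1.
Qed.

Lemma coset_rep_eq i v w : (coset_rep i v == coset_rep i w) = (v^-1 * w \in H i).
Proof.
apply/eqP/idP => [e|vw].
  by apply: (gpredVr (coset_rep_in i v)); rewrite e; exact/gpredVC/coset_rep_in.
rewrite /coset_rep; have -> : [set c | v^-1 * c \in H i] = [set c | w^-1 * c \in H i].
  by apply/seteqP; split=> c /= cH;
    [apply: gpredVr (gpredVC vw) cH | apply: gpredVr vw cH].
rewrite /xget; case: pselect => // nex; exfalso; apply: nex.
by exists w; rewrite /= asboolE mulVg gpred1.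
Qed.

Definition coset_index := {t : 'I_n * G | coset_rep t.1 t.2 == t.2}.

Lemma coset_rep_idem i v : coset_rep (i, coset_rep i v).1 (i, coset_rep i v).2 == coset_rep i v.
Proof. by rewrite coset_rep_eq gpredVC // coset_rep_in. Qed.

Definition coset_of i v : coset_index := exist _ (i, coset_rep i v) (coset_rep_idem i v).

Definition in_coset (j : coset_index) v : Prop := coset_of (val j).1 v = j.

Lemma coset_of_eq i i' v w : coset_of i v = coset_of i' w <-> i = i' /\ v^-1 * w \in H i.
Proof.
split=> [/(congr1 val) /= [<- /eqP]|[<- vw]]; first by rewrite coset_rep_eq.
by apply/val_inj; congr pair; apply/eqP; rewrite coset_rep_eq.
Qed.

Lemma coset_index_rep j : coset_of (val j).1 (val j).2 = j.
Proof. by apply: val_inj; case: j => [[i v] /= /eqP ->]. Qed.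

Lemma in_cosetE j v : in_coset j v <-> (val j).2^-1 * v \in H (val j).1.
Proof.
rewrite /in_coset -{2}(coset_index_rep j) coset_of_eq.
by split=> [[_ /gpredVC]|/gpredVC].
Qed.

Lemma in_coset_of i v w : in_coset (coset_of i v) w <-> v^-1 * w \in H i.
Proof. by rewrite /in_coset /= coset_of_eq; split=> [[_ /gpredVC]|/gpredVC]. Qed.

Definition cusp_base (x : X) : G := match x with inl v => v | inr (_, v, _) => v end.

Definition cusp_height (j : coset_index) (x : X) : nat :=
  if x is inr (i, v, k) then if coset_of i v == j then k.+1 else 0%N else 0%N.

Definition cusp_point (j : coset_index) v k : X :=
  if k is k'.+1 then inr ((val j).1, v, k') else inl v.

Lemma peripheral_sym i : symmetric (peripheral_graph S (H i)).
Proof. exact: cayley_sym. Qed.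

Lemma horoball_sym i : symmetric (horoball (peripheral_graph S (H i))).
Proof.
move=> [v k] [w l]; rewrite /horoball /= (gdist_sym (@peripheral_sym i)).
by rewrite (eq_sym l k) (eq_sym w v); case: eqP => [->|_] //=; rewrite orbC.
Qed.

Lemma cusped_sym : symmetric eX.
Proof.
move=> [x|[[i v] k]] [y|[[j w] l]] /=;
  [exact: cayley_sym | exact: horoball_sym | exact: horoball_sym |].
by rewrite eq_sym; case: eqP => [->|_] //=; exact: horoball_sym.
Qed.

Lemma vertical_edge j v k : eX (cusp_point j v k) (cusp_point j v k.+1).
Proof. by case: k => [|k]; rewrite /= ?eqxx /horoball /= !eqxx ?orbT. Qed.

Lemma ground_walk x y m : walk (cayley (mem S)) x y m -> walk eX (inl x) (inl y) m.
Proof.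
move=> [p [pp <- <-]]; exists (map inl p); rewrite size_map last_map; split=> //.
by rewrite path_map.
Qed.

Lemma cusped_conn x y : exists m, walk eX x y m.
Proof.
suff down z : exists m, walk eX z (inl (cusp_base z)) m.
  have [m1 w1] := down x; have [m2 w2] := down y.
  have [m w] := generates_connected gS (cusp_base x) (cusp_base y).
  by exists (m1 + (m + m2))%N; apply: walk_cat w1 (walk_cat (ground_walk w) (walk_sym cusped_sym w2)).
case: z => [v|[[i v] k]]; first by exists 0%N; exact: walk_refl.
exists k.+1; apply: (walk_sym cusped_sym).
suff up l : walk eX (inl v) (cusp_point (coset_of i v) v l) l by exact: (up k.+1).
elim: l => [|l IH]; first exact: walk_refl.
by rewrite -[l.+1]addn1; apply: walk_cat IH _; rewrite addn1; exact/walk1/vertical_edge.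
Qed.

Lemma cusped_metric : geodesic_metric dX.
Proof. exact: gdist_geodesic_metric cusped_sym cusped_conn. Qed.

Lemma peripheral_le i v w m : walk (peripheral_graph S (H i)) v w m ->
  v^-1 * w \in H i /\ (d v w <= m)%N.
Proof.
move=> wm; split; first by apply: (walk_group (A := [predI S & H i]) _ wm) => s;
  rewrite inE => /andP[].
by apply: (proj2 (walk_gdist (walk_mono _ wm))) => s; rewrite inE => /andP[].
Qed.

Lemma gdist_peripheral i v w : (0 < gdist (peripheral_graph S (H i)) v w)%N ->
  walk (peripheral_graph S (H i)) v w (gdist (peripheral_graph S (H i)) v w).
Proof.
move=> pos; case: (pselect (exists m, walk (peripheral_graph S (H i)) v w m)).
  by case=> m wm; exact: (walk_gdist wm).1.
move=> none; move: pos; rewrite {1}/gdist; case: xgetP => // m _ [wm _].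
by case: none; exists m.
Qed.

(** The point [inr (i, v, k)] has depth [k.+1], and horizontal edges at that
depth span peripheral distance up to [2 ^ k.+1]. *)
Lemma horizontal_steps i k a v w m : walk (peripheral_graph S (H i)) v w m ->
  (m <= a * 2 ^ k.+1)%N -> (dX (inr (i, v, k)) (inr (i, w, k)) <= a)%N.
Proof.
have XG := cusped_metric; elim: a v m => [|a IH] v m wm ma.
  rewrite mul0n leqn0 in ma; rewrite (eqP ma) in wm.
  by rewrite (walk0_eq wm) (gm_refl XG).
have [z w1 w2] := walk_split wm (geq_minl m (2 ^ k.+1)).
have le2 := IH z _ w2; apply: leq_trans (gm_tri XG _ (inr (i, z, k)) _) _.
rewrite -add1n; apply: leq_add; last by apply: le2; rewrite mulSn in ma; lia.
have [e|ne] := eqVneq v z; first by rewrite e (gm_refl XG).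
apply: gdist_edge_le; rewrite /eX /= eqxx /horoball /= eqxx /=.
have [w1' le] := walk_gdist w1; apply/orP; left;
  rewrite (leq_trans le (geq_minr _ _)) andbT.
rewrite lt0n; apply/eqP => d0; rewrite d0 in w1'.
by rewrite (walk0_eq w1') eqxx in ne.
Qed.

Lemma cusped_cusping :
  cusping d in_coset dX cusp_base cusp_height inl cusp_point b.+1.
Proof.
have XG := cusped_metric.
have memE j x : (0 < cusp_height j x)%N ->
  exists i v k, x = inr (i, v, k) /\ j = coset_of i v.
  case: x => [//|[[i v] k]] /=; case: eqP => // <- _; by exists i, v, k.
split=> //.
- by move=> j x /memE[i [v [k [-> ->]]]] /=; apply/in_coset_of; rewrite mulVg gpred1.
- by move=> j j' x /memE[i [v [k [-> ->]]]] /=; case: eqP => // <-.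
- by move=> j x /memE[i [v [k [-> ->]]]] /=; rewrite eqxx.
- by case=> [//|[[i v] k]] /(_ (coset_of i v)) /=; rewrite eqxx.
- move=> v w; have [] // := walk_gdist (ground_walk (gdist_walk (generates_connected gS) v w)).
- by move=> j v k; apply: gdist_edge_le; exact: vertical_edge.
- move=> j v w [|k] /in_cosetE vj /in_cosetE wj vw /=.
    have [_] := walk_gdist (ground_walk (gdist_walk (generates_connected gS) v w)).
    by rewrite -/dX -/d; rewrite expn0 in vw; lia.
  have [m mle wm] := bP (gpredVl vj wj).
  by apply: leqW; apply: horizontal_steps wm _; apply: leq_trans mle _;
    rewrite leq_mul2l vw orbT.
move=> x y /(gdist_le1 cusped_conn)[<-|].
  case: x => [v|[[i v] k]]; first by left; rewrite (gm_refl dG).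
  by right; exists (coset_of i v); rewrite /= !eqxx (gm_refl dG).
case: x y => [v|[[i v] k]] [w|[[j w] l]] /=; rewrite /horoball /=.
- by move=> vw; left; split=> //; exact: gdist_edge_le.
- case/orP=> /andP[/eqP e /eqP e'] //; left; rewrite e (gm_refl dG); split=> // j'.
  by move: e' => [->]; case: ifP.
- case/orP=> /andP[/eqP e /eqP e'] //; left; rewrite e (gm_refl dG); split=> // j'.
  by move: e' => [->]; case: ifP.
case/andP=> /eqP <- /or3P[/andP[/eqP[<-] /andP[d1 d2]]|/andP[/eqP <- /eqP[->]]|
  /andP[/eqP <- /eqP[->]]].
- have [vw le] := peripheral_le (gdist_peripheral d1).
  right; exists (coset_of i v); have -> : coset_of i w = coset_of i v.
    by apply/coset_of_eq; split=> //; exact: gpredVC.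
  by rewrite /= !eqxx; split=> //; exact: leq_trans le d2.
- by right; exists (coset_of i v); rewrite /= !eqxx (gm_refl dG).
- by right; exists (coset_of i v); rewrite /= !eqxx (gm_refl dG); split=> //; lia.
Qed.

End CuspedSpace.

(** * Hyperbolicity of the cusped space *)

Lemma nearest_point V (d : V -> V -> nat) (A : V -> Prop) x : (exists q, A q) ->
  exists q, A q /\ forall q', A q' -> (d x q <= d x q')%N.
Proof.
move=> [q Aq]; have ex : exists m, `[< exists q, A q /\ d x q = m >].
  by exists (d x q); apply/asboolP; exists q.
case: (ex_minnP ex) => m /asboolP[q1 [Aq1 <-]] qmin; exists q1; split=> // q' Aq'.
by apply: qmin; apply/asboolP; exists q'.
Qed.

Lemma coset_family (G : groupType) n (H : 'I_n -> groupClosed G) S delta :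
  generates_group S -> four_point (gdist (cayley (mem S))) delta ->
  (forall i, quasiconvex (H i)) -> almost_malnormal H ->
  exists lam sep p,
    quasiconvex_family (gdist (cayley (mem S))) (@in_coset G n H) lam sep p.
Proof.
move=> gS dH qc mal; set d := gdist (cayley (mem S)).
have /choice[f fP] (t : nat * 'I_n) := quasiconvex_between gS dH (qc t.2) t.1.
pose lam C := \max_i f (C, i).
have lamP C i x y u : x^-1 * y \in H i -> between d C x y u ->
    exists2 q, x^-1 * q \in H i & (d u q <= lam C)%N.
  move=> xy b; have [q xq uq] := fP (C, i) x y u xy b; exists q => //.
  by apply: leq_trans uq _; exact: (leq_bigmax (F := fun i => f (C, i))).
have /choice[sep sepP] r := cosets_separated gS mal lamP r.
have /choice[p pP] (t : coset_index H * G) :=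
  @nearest_point G d (in_coset t.1) t.2 (ex_intro _ (val t.1).2 (coset_index_rep t.1)).
exists lam, sep, (fun j x => p (j, x)); split.
- move=> C j x y u /in_cosetE jx /in_cosetE jy b.
  have [q xq uq] := lamP _ _ _ _ _ (gpredVl jx jy) b.
  by exists q => //; apply/in_cosetE; exact: gpredVr jx xq.
- move=> r j j' v w ne n1 n2 n3 n4.
  have tr k z : close_to d (@in_coset G n H) r k z ->
      exists2 q, (val k).2^-1 * q \in H (val k).1 & (d z q <= r)%N.
    by case=> q /in_cosetE qk zq; exists q.
  apply: (sepP r _ _ _ _ _ _ _ (tr _ _ n1) (tr _ _ n2) (tr _ _ n3) (tr _ _ n4)).
  by move=> same; apply: ne; rewrite -(coset_index_rep j) -(coset_index_rep j') coset_of_eq.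
- by move=> j x; have [] := pP (j, x).
- by move=> j x q; have [_] := pP (j, x); exact.
Qed.

Theorem theorem1p1 (G : groupType) (n : nat) (H : 'I_n -> groupClosed G) :
  hyperbolic_group G ->
  ~ virtually_cyclic G ->
  (forall i : 'I_n, exists g : G, g \notin H i) ->
  (forall i : 'I_n, quasiconvex (H i)) ->
  almost_malnormal H ->
  relatively_hyperbolic H.
Proof.
move=> [S0 gS0 hyp0] _ _ qc mal.
have conn0 := generates_connected gS0.
have [delta0 dH0] := gromov_four_point (@cayley_sym _ _) hyp0.
have /choice[T TP] i := quasiconvex_undistorted gS0 (qc i).
have /choice[c cP] := TP.
pose S := S0 ++ flatten [seq T i | i <- enum 'I_n].
have TS i s : s \in T i -> s \in S.
  move=> sT; rewrite mem_cat; apply/orP; right; apply/flattenP; exists (T i) => //.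
  by apply: map_f; rewrite mem_enum.
have gS : generates_group S.
  by move=> K SK; apply: gS0 => s sS; apply: SK; rewrite mem_cat sS.
have [c1 c1P] := gdist_lipschitz gS0 gS; have [c2 c2P] := gdist_lipschitz gS gS0.
have dG0 := cayley_metric gS0; have dG := cayley_metric gS.
have [delta dH] : exists delta, four_point (gdist (cayley (mem S))) delta.
  apply: (bilipschitz_hyperbolic (c := (c1 + c2)%N) dG0 dH0 dG) => x y.
    by have := c1P x y; nia.
  by have := c2P x y; nia.
have TW i x y m : walk (cayley (mem (T i))) x y m ->
  walk (peripheral_graph S (H i)) x y m.
  apply: walk_mono => s sT; rewrite inE /= (TS i) //=.
  by have [TH _] := cP i; exact: TH.
pose b := ((\max_i c i) * c2)%N.
have bP i x y : x^-1 * y \in H i -> exists2 m,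
    (m <= b * gdist (cayley (mem S)) x y)%N & walk (peripheral_graph S (H i)) x y m.
  move=> xy; have [_ /(_ x y xy)[m mle /TW w]] := cP i; exists m => //.
  have := c2P x y; have := leq_bigmax (F := c) i; rewrite /b; nia.
exists S; split=> //.
- move=> i; split=> [s|K SK g gH]; first by rewrite inE => /andP[].
  have [|m _ w] := bP i 1 g; first by rewrite invg1 mul1g.
  by have := walk_group SK w; rewrite invg1 mul1g.
- have [lam [sep [p QF]]] := coset_family gS dH qc mal.
  have XG := cusped_metric H gS.
  have [d' dH'] := cusping_hyperbolic dG dH QF XG (cusped_cusping gS bP).
  exact: (four_point_gromov (@cusped_sym _ _ _ _) dH').
Qed.
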